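(* With the partial multifunctions and reducibility defined in the context: (1) $\mathsf{RDIV}\not\le^c_{\Game{\sf W}}\mathsf{BE}$; (2) $\mathsf{BE}_\mathbb{Q}\not\le^c_{\Game{\sf W}}\mathsf{RDIV}$; (3) $\mathsf{IVT}_{\rm lin}\not\le^c_{\Game{\sf W}}\mathsf{RDIV}\times\mathsf{BE}$; (4) $\mathsf{BE}\not\le^c_{\Game{\sf W}}\Sigma^0_2\text{-}\mathsf{DML}_\mathbb{R}\times\Sigma^0_2\text{-}\mathsf{DNE}_\mathbb{R}$; (5) $\mathsf{IVT}\not\le^c_{\Game{\sf W}}\Sigma^0_2\text{-}\mathsf{DML}_\mathbb{R}\times\Sigma^0_2\text{-}\mathsf{DNE}_\mathbb{R}\times\mathsf{BE}$.
   Context: All problems are partial multifunctions $\subseteq\omega^\omega\rightrightarrows\omega^\omega$ (finite tuples, rationals etc. coded into $\omega^\omega$). Reduction game $G(f,g)$: Player I first plays $x_0\in\mathrm{dom}(f)$; at round $n$ Player II plays $\langle j,u_n\rangle$: $j=0$ means a query $u_n$ to $g$ (required $u_n\in\mathrm{dom}(g)$), $j=1$ means II declares victory with $u_n$; after a query Player I must answer with $x_{n+1}\in g(u_n)$. Player II wins if Player I violates the rules before II does, or II obeys the rules and declares victory with some $u_n\in f(x_0)$. A strategy for II is (a code of) a partial continuous function from finite sequences of I's moves to II's next move. $f\le^c_{\Game{\sf W}}g$ means II has a continuous winning strategy in $G(f,g)$. Product: $(f\times g)(\langle x,y\rangle)=\{\langle u,v\rangle:u\in f(x),v\in g(y)\}$.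 A real is given by a regular Cauchy name, a sequence of rationals $(q_n)$ with $|q_n-q_m|<2^{-n}$ for $m\ge n$. $\mathsf{BE}$: given a name of $x\in[0,1]$, output any $f\in 2^\omega$ with $x=\sum_n f(n)2^{-(n+1)}$. $\mathsf{BE}_\mathbb{Q}$: $\mathsf{BE}$ restricted to names of rational $x$. $\mathsf{RDIV}$: given names of $x,y\in[0,1]$ with $x\le y$, output a name of some $z\in[0,1]$ with $x=yz$. $\mathsf{IVT}$: given a code of a continuous $f\colon[0,1]\to[-1,1]$ with $f(0),f(1)$ of different signs (codes: sequences $(\bar p^s)_s$ of finite lists of rational points in the plane, each determining a rational piecewise linear map $f_s$, with each point of $\bar p^{s+1}$ within $2^{-s-1}$ of the graph of $f_s$, $f=\lim f_s$), output a name of some $x\in[0,1]$ with $f(x)=0$. $\mathsf{IVT}_{\rm lin}$: the restriction of this problem (with $f(0)<0<f(1)$) to codes $(\bar p^s)$ that are eventually constant. $\Sigma^0_2\text{-}\mathsf{DNE}_\mathbb{R}$: given $\varphi\colon\mathbb{N}^2\to\{0,1\}$ with $\exists a\forall b\,\varphi(a,b)=1$, output $a$ with $\forall b\,\varphi(a,b)=1$. $\Sigma^0_2\text{-}\mathsf{DML}_\mathbb{R}$: given $\varphi_0,\varphi_1\colon\mathbb{N}^2\to\{0,1\}$ such that not both $\exists a\forall b\,\varphi_i(a,b)=1$ hold, output $i\in\{0,1\}$ with $\forall a\exists b\,\varphi_i(a,b)=0$. *)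

(* Defs.v *)
From HB Require Import structures.
From mathcomp Require Import all_boot all_order all_algebra.
From mathcomp Require Import all_classical all_reals all_analysis.

Unset Printing Implicit Defensive.

Import Order.TTheory GRing.Theory Num.Theory.
Import numFieldTopology.Exports numFieldNormedType.Exports.

Local Open Scope classical_set_scope.
Local Open Scope ring_scope.

Definition baire : Type := prod_topology (fun _ : nat => nat).
HB.instance Definition _ := Pointed.on baire.
HB.instance Definition _ := Topological.on baire.

(* The value at x is the set of solutions of the instance x. *)
Definition multifun := baire -> set baire.

Definition dom (f : multifun) : set baire := [set x | f x !=set0].

(* The pairing <x, y> interleaves x and y; bfst and bsnd are its projections,
   and z |-> (bfst z, bsnd z) is a homeomorphism of baire onto its square. *)
Definition bpair (x y : baire) : baire :=
  fun n => if odd n then y n./2 else x n./2.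
Definition bfst (z : baire) : baire := fun n => z n.*2.
Definition bsnd (z : baire) : baire := fun n => z n.*2.+1.

Lemma bfstK (x y : baire) : bfst (bpair x y) = x.
Proof. by apply/funext => n; rewrite /bfst /bpair odd_double doubleK. Qed.

Lemma bsndK (x y : baire) : bsnd (bpair x y) = y.
Proof.
by apply/funext => n; rewrite /bsnd /bpair oddS odd_double/= uphalf_double.
Qed.

Lemma bpairK (z : baire) : bpair (bfst z) (bsnd z) = z.
Proof.
apply/funext => n; rewrite /bpair /bfst /bsnd.
by case: ifP => o; rewrite -[in RHS](odd_double_half n) o.
Qed.

Definition mprod (f g : multifun) : multifun :=
  fun x => [set u | f (bfst x) (bfst u) /\ g (bsnd x) (bsnd u)].

(* Player I's moves x_0, ..., x_n. *)
Definition history (n : nat) : Type :=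
  prod_topology (fun _ : 'I_n.+1 => baire).
HB.instance Definition _ n := Pointed.on (history n).
HB.instance Definition _ n := Topological.on (history n).

(* A move <j, u> of Player II: j = false is a query u, j = true declares
   victory with u. *)
Definition moveII : Type := (bool * baire)%type.
HB.instance Definition _ := Topological.on moveII.

(* The space of nonempty finite sequences is the disjoint sum of the spaces
   [history n], so a partial continuous function on it is a family of partial
   continuous functions, one for each length. *)
Record strategy := Strategy {
  sdom : forall n, set (history n);
  smove : forall n, history n -> moveII;
  _ : forall n, {within sdom n, continuous (smove n)}
}.

Section game.
Variables (f g : multifun) (S : strategy).
(* x is an infinite sequence of moves of Player I; its terms after the end of
   the game are irrelevant. *)
Variable x : nat -> baire.

Definition prefix_of n : history n := fun i : 'I_n.+1 => x i.

Definition reply n : moveII := smove S n (prefix_of n).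

Definition II_queries n :=
  [/\ sdom S n (prefix_of n), (reply n).1 = false & dom g (reply n).2].

Definition II_declares n :=
  [/\ sdom S n (prefix_of n), (reply n).1 = true & f (x 0%N) (reply n).2].

Definition I_violates n :=
  if n is k.+1 then ~ g (reply k).2 (x k.+1) else ~ dom f (x 0%N).

Definition II_wins :=
  exists n, (forall k, (k < n)%N -> II_queries k) /\
            (I_violates n \/ II_declares n).

End game.

Definition GW_le (f g : multifun) :=
  exists S : strategy, forall x : nat -> baire, II_wins f g S x.

Section problems.
Variable R : realType.

Definition regular_Cauchy (q : nat -> rat) :=
  forall n m, (n <= m)%N -> `|q n - q m| < 2^-1 ^+ n.

Definition cauchy_name (p : baire) (x : R) :=
  exists q : nat -> rat,
    [/\ forall n, p n = pickle (q n),
        regular_Cauchy q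
      & (ratr (q n) : R) @[n --> \oo] --> x].

Definition binary_expansion (u : baire) (x : R) :=
  (forall n, (u n < 2)%N) /\
  series (fun n => (u n)%:R * 2^-1 ^+ n.+1 : R) @ \oo --> x.

Definition BE_pb : multifun := fun p => [set u |
  exists x : R, [/\ 0 <= x <= 1, cauchy_name p x & binary_expansion u x]].

Definition BEQ_pb : multifun := fun p => [set u | BE_pb p u /\
  exists r : rat, cauchy_name p (ratr r)].

Definition RDIV_pb : multifun := fun p => [set u |
  exists x y z : R,
    [/\ [/\ 0 <= x <= 1, 0 <= y <= 1 & x <= y],
        cauchy_name (bfst p) x /\ cauchy_name (bsnd p) y,
        0 <= z <= 1 /\ x = y * z
      & cauchy_name u z]].

(* The vertices of the graph of a piecewise linear map on [0, 1], from left to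
   right. *)
Definition pl_list (s : seq (rat * rat)) :=
  [/\ s != [::], sorted (fun a b => a.1 < b.1) s,
      (head (0, 0) s).1 = 0 & (last (0, 0) s).1 = 1].

Fixpoint pl (s : seq (rat * rat)) (t : R) : R :=
  match s with
  | a :: ((b :: _) as s') =>
      if t <= ratr b.1 then
        ratr a.2 + ratr ((b.2 - a.2) / (b.1 - a.1)) * (t - ratr a.1)
      else pl s' t
  | [:: a] => ratr a.2
  | [::] => 0
  end.

Definition near_graph (h : R -> R) (e : R) (a : rat * rat) :=
  exists t : R, 0 <= t <= 1 /\
    Num.sqrt ((ratr a.1 - t) ^+ 2 + (ratr a.2 - h t) ^+ 2) <= e.

(* "Within e of the graph" is distance in the plane, and the limit is uniform
   on [0, 1]; only the restriction of f to [0, 1] matters. *)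
Definition function_code (P : nat -> seq (rat * rat)) (f : R -> R) :=
  [/\ forall s, pl_list (P s),
      forall s a, a \in P s.+1 -> near_graph (pl (P s)) (2^-1 ^+ s.+1) a,
      {within `[0, 1], continuous f}
    & {uniform `[0, 1], (fun s => pl (P s)) @ \oo --> f}].

Definition zero_problem (C : (nat -> seq (rat * rat)) -> (R -> R) -> Prop) :
    multifun := fun p => [set u |
  exists (P : nat -> seq (rat * rat)) (f : R -> R) (z : R),
    [/\ forall s, p s = pickle (P s),
        function_code P f /\ (forall t, 0 <= t <= 1 -> -1 <= f t <= 1),
        C P f,
        0 <= z <= 1 /\ f z = 0
      & cauchy_name u z]].

Definition IVT_pb : multifun := zero_problem (fun _ f => f 0 * f 1 < 0).

Definition IVTlin_pb : multifun := zero_problem (fun P f =>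
  f 0 < 0 < f 1 /\ exists N, forall s, (N <= s)%N -> P s = P N).

End problems.

(* A name p of a map phi from pairs of naturals to {0, 1}. *)
Definition phi_of (p : baire) (a b : nat) : nat := p (pickle (a, b)).

Definition binary_phi (p : baire) := forall a b, (phi_of p a b < 2)%N.

Definition Sigma2 (p : baire) := exists a, forall b, phi_of p a b = 1%N.

(* A natural number a is named by any u with u 0 = a. *)
Definition DNE_pb : multifun := fun p => [set u |
  [/\ binary_phi p, Sigma2 p & forall b, phi_of p (u 0%N) b = 1%N]].

Definition DML_pb : multifun := fun p => [set u |
  [/\ binary_phi (bfst p) /\ binary_phi (bsnd p),
      ~ (Sigma2 (bfst p) /\ Sigma2 (bsnd p)),
      (u 0%N < 2)%N
    & let q := if u 0%N == 0%N then bfst p else bsnd p in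
      forall a, exists b, phi_of q a b = 0%N]].

(* Main.v *)
Require Import Defs.
From mathcomp Require Import all_boot all_order all_algebra.
From mathcomp Require Import all_classical all_reals all_analysis.
From mathcomp Require Import zify ring lra.

(**
Instances are parametrised by sequences s of natural numbers in such a way that
an eventually zero s is an instance with several solutions, and that each later
nonzero entry j + 1 of a branching sequence forces the solutions into a j-th
region, these regions being separated: the two sides of a dyadic rational for
BE, infinitely many disjoint subintervals of a plateau for IVT, infinitely many
quotients for RDIV.  If Player II's continuous strategy declared victory on an
eventually zero s, at a position that is a limit of positions on a large set of
branches, then its output would be close to a solution in two separated regions.
So Player I only has to answer all queries so as to keep a position of this
kind, and thereby prolongs the play forever.

BE has at most two solutions, and its solution sets are compact and vary upper
semicontinuously, so the answers along infinitely many branches converge to one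
and the same answer for infinitely many of them.

RDIV is continuous where the divisor is positive, and any answer is correct
where it is 0.  Either some branch, branch of a branch, etc., up to a given
depth r has a positive divisor, and one moves there, or the divisor is 0 on all
of them.  Since the instance moves at every round, only arbitrarily long finite
plays near s = 0 are obtained, and compactness gives an infinite play at s = 0.

For DML and DNE, Baire category gives answers that are constant on a comeager
subset of a cylinder.  They are also correct at the eventually zero sequences,
which are limits of generic ones, except that when both Sigma^0_2 statements of
a DML query are generically false one must choose the answer that remains
correct at a somewhere dense set of eventually zero sequences.
*)

Set Implicit Arguments.
Unset Strict Implicit.
Unset Printing Implicit Defensive.
Import Order.TTheory GRing.Theory Num.Theory.
Import numFieldTopology.Exports numFieldNormedType.Exports.
Local Open Scope classical_set_scope.

(** * Games with continuous strategies *)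

Definition agree (M : nat) (u v : baire) :=
  forall k, (k < M)%N -> u k = v k.

Definition hist_agree (n M : nat) (x y : nat -> baire) :=
  forall i, (i <= n)%N -> agree M (x i) (y i).

Lemma agree_sym M u v : agree M u v -> agree M v u.
Proof. by move=> uv k kM; rewrite uv. Qed.

Lemma agree_trans M u v w : agree M u v -> agree M v w -> agree M u w.
Proof. by move=> uv vw k kM; rewrite uv// vw. Qed.

Lemma agreeW M M' u v : (M <= M')%N -> agree M' u v -> agree M u v.
Proof. by move=> MM' uv k kM; apply: uv; apply: leq_trans MM'. Qed.

Lemma hist_agree_trans n M x y z :
  hist_agree n M x y -> hist_agree n M y z -> hist_agree n M x z.
Proof. by move=> xy yz i ni; apply: agree_trans (xy _ ni) (yz _ ni). Qed.

Lemma hist_agreeW n M M' x y :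
  (M <= M')%N -> hist_agree n M' x y -> hist_agree n M x y.
Proof. by move=> MM' xy i ni; apply: agreeW MM' (xy _ ni). Qed.

Lemma agree_bfst M u v : agree M.*2 u v -> agree M (bfst u) (bfst v).
Proof. by move=> uv k kM; apply: uv; rewrite ltn_double. Qed.

Lemma agree_bsnd M u v : agree M.*2 u v -> agree M (bsnd u) (bsnd v).
Proof. by move=> uv k kM; apply: uv; rewrite ltn_Sdouble. Qed.

Lemma agree_bpair M u u' v v' :
  agree M u u' -> agree M v v' -> agree M (bpair u v) (bpair u' v').
Proof.
move=> uu vv k kM; rewrite /bpair; have kM2 : (k./2 < M)%N by lia.
by case: ifP => _; [apply: vv|apply: uu].
Qed.

(** * Infinite index sets and compactness of bounded sets in Baire space *)

Definition unbounded (A : set nat) := forall m, exists2 n, (m <= n)%N & A n.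

Lemma unbounded_setU (A B : set nat) :
  unbounded (A `|` B) -> unbounded A \/ unbounded B.
Proof.
move=> AB; apply: contrapT => /not_orP[/existsNP[m Am] /existsNP[m' Bm]].
have [n nm [An|Bn]] := AB (maxn m m').
- by apply: Am; exists n => //; rewrite (leq_trans (leq_maxl _ _) nm).
- by apply: Bm; exists n => //; rewrite (leq_trans (leq_maxr _ _) nm).
Qed.

(** Pigeonhole, by induction on the bound: the value [c.+1] or the values at most [c] occur on an
    infinite part of [A]. *)
Lemma unbounded_fiber (A : set nat) (h : nat -> nat) (c : nat) :
  unbounded A -> (forall n, A n -> (h n <= c)%N) ->
  exists v, unbounded [set n | A n /\ h n = v].
Proof.
elim: c A => [|c IH] A Ainf Ac.
  exists 0%N => m; have [n mn An] := Ainf m; exists n => //; split => //.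
  by apply/eqP; rewrite -leqn0 Ac.
have : unbounded ([set n | A n /\ (h n <= c)%N] `|`
                     [set n | A n /\ h n = c.+1]).
  move=> m; have [n mn An] := Ainf m; exists n => //=.
  have := Ac _ An; rewrite leq_eqVlt => /orP[/eqP hn|]; [by right|by left].
case/unbounded_setU => [Binf|]; last by exists c.+1.
have [|v vinf] := IH _ Binf; first by move=> n [].
by exists v => m; have [n mn [[An _] hn]] := vinf m; exists n.
Qed.

Lemma agreeS M u v : agree M u v -> u M = v M -> agree M.+1 u v.
Proof. by move=> uv uvM k; rewrite ltnS leq_eqVlt => /orP[/eqP->|/uv]. Qed.

(** Diagonal thinning: coordinate after coordinate, pigeonhole leaves an infinite set of indices on
    which that coordinate is constant; the constants form [b0]. *)
Lemma cluster_point (c : nat -> nat) (b : nat -> baire) :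
  (forall m k, (b m k <= c k)%N) ->
  exists b0 : baire, forall M, unbounded [set m | agree M b0 (b m)].
Proof.
move=> bc.
pose pick (A : set nat) k : nat :=
  xget 0%N [set v | unbounded [set n | A n /\ b n k = v]].
pose A := fix A (k : nat) : set nat :=
  if k is k'.+1 then [set n | A k' n /\ b n k' = pick (A k') k'] else setT.
exists (fun k => pick (A k) k).
have Ainf k : unbounded (A k).
  elim: k => [m|k IH]; first by exists m.
  have [|v vinf] := unbounded_fiber IH (h := b ^~ k) (c := c k).
    by move=> n _; apply: bc.
  by apply: (@xgetPex _ 0%N [set v | unbounded [set n | A k n /\ b n k = v]]);
    exists v.
move=> M m; have [n mn An] := Ainf M m; exists n => //=.
elim: M An => [|M IH] //= -[/IH An bn]; exact: agreeS.
Qed.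

(** The point [b0] is only approximated by elements of [P M]; membership of [b0] itself is left to
    closedness arguments. *)
Lemma compactness (c : nat -> nat) (P : nat -> baire -> Prop) :
  (forall M M' b, (M <= M')%N -> P M' b -> P M b) ->
  (forall M, exists2 b, P M b & forall k, (b k <= c k)%N) ->
  exists b0 : baire, forall M, exists2 b, P M b & agree M b0 b.
Proof.
move=> PW Pex.
have [b bP] := choice (fun M => (let: ex_intro2 b h1 h2 := Pex M in
  ex_intro (fun b => P M b /\ forall k, (b k <= c k)%N) b (conj h1 h2))).
have [|b0 b0P] := @cluster_point c b; first by move=> m k; apply: (bP m).2.
exists b0 => M; have [m Mm bm] := b0P M M.
by exists (b m) => //; apply: PW Mm (bP m).1.
Qed.

Definition upd (x : nat -> baire) (n : nat) (b : baire) : nat -> baire :=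
  fun i => if i == n then b else x i.

Lemma upd_eq x n b : upd x n b n = b.
Proof. by rewrite /upd eqxx. Qed.

Lemma upd_lt x n b i : (i < n)%N -> upd x n b i = x i.
Proof. by rewrite /upd => /ltn_eqF ->. Qed.

(** * Plays against a winning strategy of Player II *)

Section games.
Variables (f g : multifun).
Variables (sd : nat -> (nat -> baire) -> Prop).
Variables (rep : nat -> (nat -> baire) -> bool * baire).

Definition queries n x :=
  [/\ sd n x, (rep n x).1 = false & dom g (rep n x).2].

Definition declares n x :=
  [/\ sd n x, (rep n x).1 = true & f (x 0%N) (rep n x).2].

Definition violates n x :=
  if n is k.+1 then ~ g (rep k x).2 (x k.+1) else ~ dom f (x 0%N).

(** A continuous winning strategy with the topology unfolded: [sd] and [rep] read a whole sequence
    of moves, [sd_ext] confines [sd] to the first [n.+1] of them, and continuity is expressed by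
    moduli of agreement. *)
Record winning : Prop := Winning {
  sd_ext : forall n x y, (forall i, (i <= n)%N -> x i = y i) ->
    sd n x -> sd n y ;
  rep_cont : forall n x, sd n x -> forall M, exists M', forall y, sd n y ->
    hist_agree n M' x y ->
    (rep n x).1 = (rep n y).1 /\ agree M (rep n x).2 (rep n y).2 ;
  wins : forall x, exists n, (forall k, (k < n)%N -> queries k x) /\
    (violates n x \/ declares n x) }.

Hypothesis W : winning.

(** Histories equal up to [n] agree to every precision, so continuity makes the replies agree to
    every precision. *)
Lemma rep_ext n x y : (forall i, (i <= n)%N -> x i = y i) ->
  sd n x -> rep n x = rep n y.
Proof.
move=> xy sx; have sy := sd_ext W xy sx.
have h M : (rep n x).1 = (rep n y).1 /\ agree M (rep n x).2 (rep n y).2.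
  have [M' /(_ y sy)] := rep_cont W sx M; apply => i ni k _.
  by rewrite xy.
rewrite [LHS]surjective_pairing [RHS]surjective_pairing (h 0%N).1; congr pair.
by apply/funext => k; apply: (h k.+1).2.
Qed.

Lemma queries_ext n x y : (forall i, (i <= n)%N -> x i = y i) ->
  queries n x -> queries n y.
Proof.
move=> xy [sx r1 r2]; have rE := rep_ext xy sx.
by split; rewrite -?rE//; apply: (sd_ext W xy).
Qed.

Variable K : baire -> baire -> Prop.
Hypothesis Kg : forall u b, K u b -> g u b.

Definition Kplay n x :=
  dom f (x 0%N) /\
  forall k, (k < n)%N -> queries k x /\ K (rep k x).2 (x k.+1).

Lemma Kplay_ext n x y : (forall i, (i <= n)%N -> x i = y i) ->
  Kplay n x -> Kplay n y.
Proof.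
move=> xy [dx kx]; split; first by rewrite -xy.
move=> k kn; have [qx Kx] := kx _ kn.
have xyk i : (i <= k)%N -> x i = y i.
  by move=> ik; apply: xy; rewrite (leq_trans ik)// ltnW.
split; first exact: queries_ext qx.
by rewrite -(rep_ext xyk)// -?xy//; case: qx.
Qed.

Lemma KplayS n x : Kplay n x -> queries n x -> K (rep n x).2 (x n.+1) ->
  Kplay n.+1 x.
Proof.
move=> [dx kx] qx Kx; split => // k; rewrite ltnS leq_eqVlt.
by case/orP => [/eqP->//|/kx].
Qed.

Lemma Kplay_upd n x b : Kplay n x -> queries n x -> K (rep n x).2 b ->
  Kplay n.+1 (upd x n.+1 b).
Proof.
move=> kx qx Kx.
have e i : (i <= n)%N -> x i = upd x n.+1 b i by move=> ni; rewrite upd_lt.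
apply: KplayS; first exact: Kplay_ext kx.
- exact: queries_ext qx.
- by rewrite upd_eq -(rep_ext e)//; case: qx.
Qed.

Lemma KplayW n m x : (n <= m)%N -> Kplay m x -> Kplay n x.
Proof.
by move=> nm [dx kx]; split => // k kn; apply: kx; apply: leq_trans nm.
Qed.

(** The round at which the game is decided cannot come before [n]: until then Player I obeys the
    rules and Player II only queries. *)
Lemma Kplay_next n x : Kplay n x -> queries n x \/ declares n x.
Proof.
move=> [dx kx]; have [m [qm vd]] := wins W x.
have [nm|mn|nm] := ltngtP n m; first by left; apply: qm.
- case: vd => [|[_ r1 _]].
    case: m mn {qm} => [|m] mn /=; first by [].
    by case; apply: Kg; apply: (kx m (ltnW mn)).2.
  by have [[_ r2 _] _] := kx _ mn; rewrite r1 in r2.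
- subst m; case: vd; last by right.
  case: n kx {qm} => [|n] kx /=; first by [].
  by case; apply: Kg; apply: (kx n (ltnSn n)).2.
Qed.

Lemma no_infinite_play x : ~ forall n, Kplay n x.
Proof.
move=> kx; have [m [qm vd]] := wins W x.
case: vd => [|[_ r1 _]].
  case: m {qm} => [|m] /=; first by case: (kx 0%N).
  by case; apply: Kg; apply: ((kx m.+1).2 m (ltnSn m)).2.
by have [[_ r2 _] _] := (kx m.+1).2 m (ltnSn m); rewrite r1 in r2.
Qed.

Lemma Kplay_sd n x : Kplay n x -> sd n x.
Proof. by case/Kplay_next => -[]. Qed.

Lemma Kplay_cont n x M : Kplay n x -> exists2 M', (M <= M')%N &
  forall y, Kplay n y -> hist_agree n M' x y ->
    (rep n x).1 = (rep n y).1 /\ agree M (rep n x).2 (rep n y).2.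
Proof.
move=> /Kplay_sd sx; have [M' hM'] := rep_cont W sx M.
exists (maxn M M'); first exact: leq_maxl.
move=> y /Kplay_sd sy /(hist_agreeW (leq_maxr _ _)); exact: hM'.
Qed.

End games.

(** * Topology of Baire space, and strategies in terms of moduli *)

Lemma prod_topology_cvg (I : Type) (T : I -> topologicalType)
    (F : set_system (prod_topology T)) (f : prod_topology T) : Filter F ->
  (forall i (B : set (T i)), nbhs (f i) B -> F [set h | B (h i)]) -> F --> f.
Proof.
move=> FF h; apply/cvg_sup => i A [_ [[B Bop <-] Bf BA]].
apply: filterS BA _; apply: h; exact: open_nbhs_nbhs.
Qed.

Lemma nbhs_agree (u : baire) M : nbhs u [set v | agree M u v].
Proof.
elim: M => [|M IH]; first by apply: filterS filterT.
have uM : nbhs u [set v | u M = v M].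
  have pM := @proj_continuous nat (fun=> nat) M u [set u M].
  by apply: filterS (pM (discrete_set1 _)) => v /= <-.
by apply: filterS2 IH uM => v; exact: agreeS.
Qed.

Lemma nbhs_baire (u : baire) (B : set baire) : nbhs u B ->
  exists M, forall v, agree M u v -> B v.
Proof.
pose F : set_system baire := filter_from setT (fun M => [set v | agree M u v]).
have FF : Filter F.
  apply: filter_from_filter; first by exists 0%N.
  move=> i j _ _; exists (maxn i j) => // v uv.
  by split; apply: agreeW uv; rewrite ?leq_maxl ?leq_maxr.
have : F --> u.
  apply: prod_topology_cvg => i C /nbhs_singleton Ci.
  by exists i.+1 => // v /(_ i (ltnSn i)) /= <-.
by move=> Fu hB; have [M _ MB] := Fu B hB; exists M.
Qed.

Lemma nbhs_history n (h : history n) (B : set (history n)) : nbhs h B ->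
  exists M, forall h', (forall i, agree M (h i) (h' i)) -> B h'.
Proof.
pose F : set_system (history n) :=
  filter_from setT (fun M => [set h' | forall i, agree M (h i) (h' i)]).
have FF : Filter F.
  apply: filter_from_filter; first by exists 0%N.
  move=> i j _ _; exists (maxn i j) => // h' hh'.
  by split => k; apply: agreeW (hh' k); rewrite ?leq_maxl ?leq_maxr.
have : F --> h.
  apply: prod_topology_cvg => i C /nbhs_baire[M MC].
  by exists M => // h' /(_ i) /MC.
by move=> Fu hB; have [M _ MB] := Fu B hB; exists M.
Qed.

Lemma GW_le_winning (f g : multifun) : GW_le f g ->
  exists sd rep, winning f g sd rep.
Proof.
move=> [S Swin].
exists (fun n x => sdom S n (prefix_of x n)), (fun n x => reply S x n).
split; last first.
- by move=> x; have [n [h1 h2]] := Swin x; exists n; split.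
- move=> n x sx M; rewrite /reply.
  case: S sx {Swin} => sdo smo /= smoc sx.
  have := smoc n => /subspace_continuousP/(_ _ sx) h.
  (* The kind of the move is a discrete coordinate, so fixing it still gives a neighbourhood. *)
  pose V : set moveII := [set m | (smo n (prefix_of x n)).1 = m.1 /\
                                 agree M (smo n (prefix_of x n)).2 m.2].
  have nV : nbhs (smo n (prefix_of x n)) V.
    exists ([set (smo n (prefix_of x n)).1],
            [set v | agree M (smo n (prefix_of x n)).2 v]).
      by split; [exact: discrete_set1|exact: nbhs_agree].
    by move=> [m1 m2] [/= -> ?].
  have /nbhs_history[M' hM'] := h V nV.
  by exists M' => y sy xy; apply: (hM' (prefix_of y n)) => // i;
    apply: xy; rewrite -ltnS.
- move=> n x y xy; suff -> : prefix_of x n = prefix_of y n by [].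
  by apply/funext => i; apply: xy; rewrite -ltnS.
Qed.

(** The maps [q] and [a] reduce [g] to [g']: Player II keeps the old strategy, sends queries through
    [q] and reads answers through [a]. The instance of [f] and the declared solution stay as they
    are. *)
Lemma winning_translate (f g g' : multifun) (q a : baire -> baire) :
  (forall M, exists M', forall u v, agree M' u v -> agree M (q u) (q v)) ->
  (forall M, exists M', forall u v, agree M' u v -> agree M (a u) (a v)) ->
  (forall u, dom g u -> dom g' (q u)) ->
  (forall u b, g' (q u) b -> g u (a b)) ->
  (exists sd rep, winning f g sd rep) -> exists sd rep, winning f g' sd rep.
Proof.
move=> qc ac dg ag [sd [rep W]].
pose tr (x : nat -> baire) i := if i is 0 then x 0%N else a (x i).
exists (fun n x => sd n (tr x)), (fun n x => let m := rep n (tr x) in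
  (m.1, if m.1 then m.2 else q m.2)); split.
- move=> n x y xy; apply: (sd_ext W) => -[_|i ni] /=; last by rewrite xy.
  exact: xy.
- move=> n x sx M; have [Mq hMq] := qc M.
  have [M1 hM1] := rep_cont W sx (maxn M Mq); have [Ma hMa] := ac M1.
  exists (maxn M1 Ma) => y sy xy /=; have [||-> r2] := hM1 (tr y) => //.
    move=> [ni|i ni] /=; first exact: agreeW (leq_maxl _ _) (xy _ ni).
    by apply: hMa; apply: agreeW (leq_maxr _ _) (xy _ ni).
  split => //; case: ifP => _; first exact: agreeW (leq_maxl _ _) r2.
  by apply: hMq; apply: agreeW (leq_maxr _ _) r2.
- move=> x; have [n [qn vd]] := wins W (tr x); exists n; split.
    by move=> k /qn[sk r1 r2]; split => //=; rewrite r1; apply: dg.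
  case: vd => [v|[sx r1 fx]]; [left|right].
    case: n qn v => [|n] qn //= v gx; apply: v.
    by have [_ r1 _] := qn n (ltnSn n); rewrite r1 in gx; apply: ag.
  by split => //=; rewrite r1.
Qed.

(** * Queries to a tame problem times a compact one *)

Definition closed_rel (D : set baire) (K : baire -> baire -> Prop) :=
  forall u b, D u ->
    (forall M, exists u' b', [/\ agree M u u', agree M b b' & K u' b']) ->
    K u b.

Definition bounded_rel (c : nat -> nat) (K : baire -> baire -> Prop) :=
  forall u b, K u b -> forall k, (b k <= c k)%N.

Definition compact_pb (E : multifun) :=
  (exists c, bounded_rel c E) /\ closed_rel (dom E) E.

(** The entry is [j.+1] because 0 stands for not branching. The base [sigma] is zero from [m] on,
    while [sigma'] is free after [m] and may branch again. *)
Definition branch (sigma : baire) (j : nat) (sigma' : baire) :=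
  exists m, [/\ agree m sigma sigma', sigma' m = j.+1 &
    forall k, (m <= k)%N -> sigma k = 0%N].

Definition evt0 (sigma : baire) :=
  exists m, forall k, (m <= k)%N -> sigma k = 0%N.

Definition zero_seq : baire := fun=> 0%N.

Definition prefix_monotone (Phi : baire -> baire) :=
  forall M s s', agree M s s' -> agree M (Phi s) (Phi s').

(* The solutions of the instances branching off Phi sigma cannot be predicted
   from a single solution of Phi sigma, whatever large set of branches is left;
   H is the notion of largeness. *)
Definition hard_at (f : multifun) (Phi : baire -> baire) (H : set (set nat))
    (sigma : baire) :=
  forall u (A : set nat), H A -> f (Phi sigma) u ->
  exists2 j, A j & exists M, forall sigma' u', branch sigma j sigma' ->
    f (Phi sigma') u' -> ~ agree M u u'.

Definition up_closed (H : set (set nat)) :=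
  forall A B : set nat, A `<=` B -> H A -> H B.

(** The answers [e] colour a large set of directions by solutions of one instance, and some colour
    class must again be large. *)
Definition partition_regular (E : multifun) (H : set (set nat)) :=
  forall u (A : set nat) (e : nat -> baire), H A ->
  (forall j, A j -> E u (e j)) ->
  exists2 b, E u b & H [set j | A j /\ e j = b].

(* The answers of an instance with O can be followed continuously, through S;
   all the instances without O share the answer z0. *)
Record tame (gR : multifun) (KR S : baire -> baire -> Prop) (O : set baire)
    (z0 : baire) (c : nat -> nat) : Prop := Tame {
  tame_sub : forall u b, KR u b -> gR u b ;
  tame_bounded : bounded_rel c KR ;
  tame_closed : closed_rel (dom gR) KR ;
  tame_open : forall u, dom gR u -> O u -> exists M, forall u', dom gR u' ->
    agree M u u' -> O u' ;
  tame_S : forall u b, S u b -> KR u b ;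
  tame_exS : forall u, dom gR u -> O u -> exists b, S u b ;
  tame_lsc : forall u b, dom gR u -> O u -> S u b -> forall M, exists M',
    forall u', dom gR u' -> O u' -> agree M' u u' ->
    exists2 b', S u' b' & agree M b b' ;
  tame_z0 : forall u, dom gR u -> ~ O u -> KR u z0 }.

(** * Trees of branching positions *)

Section largeness.
Variable H : set (set nat).
Hypothesis H_up : up_closed H.
Variable n : nat.
Implicit Types P Q : baire -> (nat -> baire) -> Prop.

(** A tree of height [r] whose nodes satisfy [P]. A node has no single child in direction [j]: it is
    a limit of roots of subtrees on [j]-th branches, so that continuity can compare them with the
    node. *)
Fixpoint Big P (r : nat) (s : baire) (x : nat -> baire) : Prop :=
  if r is r'.+1 then P s x /\ H [set j | forall M, exists s' y,
    [/\ branch s j s', agree M s s', hist_agree n M x y & Big P r' s' y]]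
  else P s x.

Lemma Big_base P r s x : Big P r s x -> P s x.
Proof. by case: r => [|r] // []. Qed.

Lemma BigW P r k s x : (k <= r)%N -> Big P r s x -> Big P k s x.
Proof.
elim: r k s x => [|r IH] [|k] s x //=; first by move=> _ [].
move=> kr [Px Hx]; split => //; apply: H_up Hx => j /= h M.
by have [s' [y [b1 b2 b3 /IH b4]]] := h M; exists s', y; split => //; apply: b4.
Qed.

(** Each node of the lower [r] levels still carries a tree of height [k], and that tree is what
    yields [Q]. *)
Lemma Big_local P Q k (s0 : baire) M0 :
  (forall s x, agree M0 s0 s -> Big P k s x -> Q s x) ->
  forall r s x, agree M0 s0 s -> Big P (r + k) s x -> Big Q r s x.
Proof.
move=> PQ; elim=> [|r IH] s x s0s; first exact: PQ.
move=> hB; split.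
  by apply: PQ => //; apply: BigW hB; rewrite leq_addl.
move: hB; rewrite addSn /= => -[_]; apply: H_up => j /= h M.
have [s' [y [b1 b2 b3 b4]]] := h (maxn M0 M); exists s', y; split => //.
- exact: agreeW (leq_maxr _ _) b2.
- exact: hist_agreeW (leq_maxr _ _) b3.
- by apply: IH b4; apply: agree_trans s0s _; apply: agreeW (leq_maxl _ _) b2.
Qed.

(** Being open relative to [P], the condition [Q] passes from a node to all branches close enough to
    it, and the limits only need those. *)
Lemma Big_open P Q :
  (forall s x, P s x -> Q s x -> exists M, forall s' y, P s' y ->
     agree M s s' -> hist_agree n M x y -> Q s' y) ->
  forall r s x, Big P r s x -> Q s x -> Big (fun s x => P s x /\ Q s x) r s x.
Proof.
move=> Qo; elim=> [|r IH] s x //= [Px Hx] Qx; split => //.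
have [M0 hM0] := Qo _ _ Px Qx; apply: H_up Hx => j h M.
have [s' [y [b1 b2 b3 b4]]] := h (maxn M0 M); exists s', y; split => //.
- exact: agreeW (leq_maxr _ _) b2.
- exact: hist_agreeW (leq_maxr _ _) b3.
- apply: IH => //; apply: hM0; first exact: Big_base b4.
  + exact: agreeW (leq_maxl _ _) b2.
  + exact: hist_agreeW (leq_maxl _ _) b3.
Qed.

End largeness.

Section tame_times_compact.
Variables (f gR E : multifun) (Phi : baire -> baire) (H : set (set nat)).
Variables (KR S : baire -> baire -> Prop) (O : set baire) (z0 : baire).
Variables (cR : nat -> nat).
Hypothesis H_up : up_closed H.
Hypothesis Phi_lip : prefix_monotone Phi.
Hypothesis E_compact : compact_pb E.
Hypothesis E_regular : partition_regular E H.
Hypothesis R_tame : tame gR KR S O z0 cR.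
Variables (sd : nat -> (nat -> baire) -> Prop).
Variables (rep : nat -> (nat -> baire) -> bool * baire).
Hypothesis W : winning f (mprod gR E) sd rep.

Let K (u b : baire) := KR (bfst u) (bfst b) /\ E (bsnd u) (bsnd b).

Let K_sub u b : K u b -> mprod gR E u b.
Proof. by move=> [k1 k2]; split => //; apply: tame_sub R_tame _ _ k1. Qed.

Let play n x := Kplay f (mprod gR E) sd rep K n x.
Let quer n x := queries (mprod gR E) sd rep n x.

Let position n s x := x 0%N = Phi s /\ play n x.

(** A solution declared at [s] would by continuity be declared, up to [M], at nearby positions on
    the [j]-th branch, which hardness excludes. *)
Lemma Big_queries n s x : hard_at f Phi H s ->
  Big H n (position n) 1 s x -> quer n x.
Proof.
move=> f_hard /= [[x0 px] Hx].
have [//|[sx r1 fx]] := Kplay_next W K_sub px.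
rewrite x0 in fx; have [j /= hj [M hM]] := f_hard _ _ Hx fx.
have [M' MM' hM'] := Kplay_cont W K_sub M px.
have [s' [y [b1 b2 b3 [y0 py]]]] := hj M'.
have [r1' r2'] := hM' _ py b3.
have [[_ q1 _]|[_ _ fy]] := Kplay_next W K_sub py.
  by rewrite -r1' r1 in q1.
by case: (hM s' (rep n y).2 b1); rewrite -?y0.
Qed.

Let dom_l u : dom (mprod gR E) u -> dom gR (bfst u).
Proof. by move=> [b []]; exists (bfst b). Qed.

Let dom_r u : dom (mprod gR E) u -> dom E (bsnd u).
Proof. by move=> [b []]; exists (bsnd b). Qed.

(* On a class Q of gR-instances with the continuous answers S0, the compactness
   of E and the regularity of H leave one E-answer to a large set of branches. *)
Lemma Big_answer (Q : set baire) (S0 : baire -> baire -> Prop) n :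
  (forall u b, S0 u b -> KR u b) ->
  (forall u b, dom gR u -> Q u -> S0 u b -> forall M, exists M',
    forall u', dom gR u' -> Q u' -> agree M' u u' ->
    exists2 b', S0 u' b' & agree M b b') ->
  forall r s x z,
  Big H n (fun s x => (position n s x /\ quer n x) /\ Q (bfst (rep n x).2))
    r s x ->
  S0 (bfst (rep n x).2) z ->
  exists2 e, E (bsnd (rep n x).2) e &
    Big H n.+1 (position n.+1) r s (upd x n.+1 (bpair z e)).
Proof.
move=> S0K S0c.
have pos_upd s x z e : position n s x -> quer n x -> S0 (bfst (rep n x).2) z ->
    E (bsnd (rep n x).2) e -> position n.+1 s (upd x n.+1 (bpair z e)).
  move=> [x0 px] qx S0x Ex; split; first by rewrite upd_lt.
  apply: (Kplay_upd W) => //; split; first by rewrite bfstK; apply: S0K.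
  by rewrite bsndK.
elim=> [|r IH] s x z hB S0z.
  have [[px qx] Qx] := hB.
  have [e Ee] : dom E (bsnd (rep n x).2) by apply: dom_r; case: qx.
  by exists e => //=; apply: pos_upd.
have [[[px qx] Qx] Hx] := hB.
set A := [set j | _] in Hx.
have [c Ec] := E_compact.1.
have hex j : exists ej, A j -> E (bsnd (rep n x).2) ej /\
    forall M, exists s' y, [/\ branch s j s', agree M s s',
      hist_agree n.+1 M (upd x n.+1 (bpair z ej)) y &
      Big H n.+1 (position n.+1) r s' y].
  have [Aj|nAj] := pselect (A j); last by exists zero_seq.
  (* A cluster point of these answers, taken ever closer to [s] in direction [j], becomes the
     candidate answer for that direction. *)
  pose P M e := exists s' y z', [/\ branch s j s', agree M s s',
    hist_agree n M x y, agree M z z' & agree M (rep n x).2 (rep n y).2] /\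
    E (bsnd (rep n y).2) e /\
    Big H n.+1 (position n.+1) r s' (upd y n.+1 (bpair z' e)).
  have PW M M' b : (M <= M')%N -> P M' b -> P M b.
    move=> MM' [s' [y [z' [[b1 b2 b3 b4 b5] b6]]]]; exists s', y, z'.
    by split => //; split => //; [exact: agreeW b2|exact: hist_agreeW b3|
      exact: agreeW b4|exact: agreeW b5].
  have Pex M : exists2 b, P M b & forall k, (b k <= c k)%N.
    have [|M1 hM1] := S0c (bfst (rep n x).2) z _ Qx S0z M.
      by apply: dom_l; case: qx.
    have [M2 M12 hM2] := Kplay_cont W K_sub (maxn M M1.*2) px.2.
    have [s' [y [b1 b2 b3 b4]]] := Aj M2.
    have [[[_ py] qy] Qy] := Big_base b4.
    have [_ r2] := hM2 _ py b3.
    have [|||z' S0z' zz'] := hM1 (bfst (rep n y).2) => //.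
    - by apply: dom_l; case: qy.
    - by apply: agree_bfst; apply: agreeW (leq_maxr _ _) r2.
    have [e Ee hBe] := IH _ _ _ b4 S0z'.
    exists e; last exact: Ec Ee.
    have MM2 : (M <= M2)%N by apply: leq_trans (leq_maxl _ _) M12.
    exists s', y, z'; split => //; split => //; first exact: agreeW b2.
    + exact: hist_agreeW b3.
    + exact: agreeW (leq_maxl _ _) r2.
  have [e he] := compactness PW Pex.
  exists e => _; split.
    apply: E_compact.2; first by apply: dom_r; case: qx.
    move=> M; have [b [s' [y [z' [[_ _ _ _ b5] [b6 _]]]]] eb] := he M.*2.
    exists (bsnd (rep n y).2), b; split => //; first exact: agree_bsnd.
    by apply: agreeW eb; lia.
  move=> M; have [b [s' [y [z' [[b1 b2 b3 b4 b5] [_ b6]]]]] eb] := he M.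
  exists s', (upd y n.+1 (bpair z' b)); split => // i.
  rewrite leq_eqVlt => /orP[/eqP->|ni].
    by rewrite !upd_eq; apply: agree_bpair.
  by rewrite !upd_lt//; apply: b3.
have [ej hej] := choice hex.
(* Different directions may call for different answers; regularity keeps a large set of directions
   sharing one. *)
have [|e Ee He] := E_regular Hx (u := bsnd (rep n x).2) (e := ej).
  by move=> j /hej[].
exists e => //; split; first exact: pos_upd.
by apply: H_up He => j /= [/hej[_ h] <-].
Qed.

(** Before any answer the position is just [Phi s]. One nonzero entry at [maxn m M] branches off in
    direction [j] and leaves the sequence eventually zero, so the construction can be repeated. *)
Lemma Big_start s x : x 0%N = Phi s -> H setT ->
  (forall s, evt0 s -> dom f (Phi s)) ->
  evt0 s -> forall r, Big H 0 (position 0) r s x.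
Proof.
move=> x0 HT fdom s0 r; elim: r s x x0 s0 => [|r IH] s x x0 s0.
  by split => //; split => //; rewrite x0; apply: fdom.
split; first by split => //; split => //; rewrite x0; apply: fdom.
have [m hm] := s0.
apply: H_up HT => j _ M.
pose s' : baire := fun k => if (k < maxn m M)%N then s k else
  if k == maxn m M then j.+1 else 0%N.
have ss' : agree (maxn m M) s s' by move=> k km; rewrite /s' km.
have ssM : agree M s s' by apply: agreeW ss'; apply: leq_maxr.
exists s', (fun=> Phi s'); split => //.
- exists (maxn m M); split => //; first by rewrite /s' ltnn eqxx.
  by move=> k mk; apply: hm; apply: leq_trans mk; apply: leq_maxl.
- by move=> i; rewrite leqn0 => /eqP->; rewrite x0; apply: Phi_lip.
- apply: IH => //; exists (maxn m M).+1 => k mk.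
  by rewrite /s' ltnNge (ltnW mk)/= gtn_eqF.
Qed.

(** Only closeness to [zero_seq] is kept, because a round may move the position to a branch;
    arbitrary height pays for the levels lost in each round. *)
Let approachable n := forall r M, exists s x,
  agree M zero_seq s /\ Big H n (position n) r s x.

Lemma approachableS n : (forall s, hard_at f Phi H s) ->
  approachable n -> approachable n.+1.
Proof.
move=> f_hard An r M.
pose Pq s x := position n s x /\ quer n x.
have AnQ r' : exists s x, agree M zero_seq s /\ Big H n Pq r' s x.
  have [s [x [Ms Bx]]] := An (r' + 1)%N M; exists s, x; split => //.
  apply: (Big_local H_up (k := 1) _ Ms Bx) => s1 x1 _ B1; split.
    exact: Big_base B1.
  exact: Big_queries (f_hard s1) B1.
(* If [O] holds at the root of some such tree, the position moves there; [O] being open, the answers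
   then follow [S]. *)
have [[s [x [Ms Bx Ox]]]|noO] := pselect (exists s x,
    [/\ agree M zero_seq s, Big H n Pq r s x & O (bfst (rep n x).2)]).
  have Ob : Big H n (fun s x => Pq s x /\ O (bfst (rep n x).2)) r s x.
    apply: (Big_open H_up _ Bx Ox) => s1 x1 [[_ px] qx] Ox1.
    have [|M1 hM1] := tame_open R_tame _ Ox1; first by apply: dom_l; case: qx.
    have [M2 _ hM2] := Kplay_cont W K_sub M1.*2 px.
    exists M2 => s' y [[_ py] qy] _ xy; apply: hM1.
      by apply: dom_l; case: qy.
    by apply: agree_bfst; apply: (hM2 _ py xy).2.
  have [|z Sz] := tame_exS R_tame _ Ox.
    by apply: dom_l; case: (Big_base Bx) => _ [].
  have [e _ hB] := Big_answer (tame_S R_tame) (tame_lsc R_tame) Ob Sz.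
  by exists s; eexists; split; [|exact: hB].
(* With height [r + r], every node of the lower [r] levels is itself the root of a tree of height
   [r], so [O] fails at it and [z0] answers all of them. *)
have [s [x [Ms Bx]]] := AnQ (r + r)%N.
have Ob : Big H n (fun s x => Pq s x /\ ~ O (bfst (rep n x).2)) r s x.
  apply: (Big_local H_up _ Ms Bx) => s' y Ms' By; split.
    exact: Big_base By.
  by move=> Oy; apply: noO; exists s', y.
pose S0 u b := (dom gR u /\ ~ O u) /\ b = z0.
have [|||e _ hB] := @Big_answer (~` O) S0 n _ _ _ _ _ z0 Ob.
- by move=> u b [[du nOu] ->]; apply: tame_z0 R_tame _ du nOu.
- by move=> u b du nOu [_ ->] M'; exists 0%N => u' du' nOu' _; exists z0.
- split => //; have [[_ [_ _ q]] nOx] := Big_base Ob.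
  by split => //; apply: dom_l.
by exists s; eexists; split; [|exact: hB].
Qed.

(** The answers in longer and longer plays near [x0] are uniformly bounded; a cluster point of them
    is an infinite play on [x0], by continuity of the replies and closedness of [K]. *)
Lemma limit_play x0 : dom f x0 ->
  (forall n, exists x, agree n x0 (x 0%N) /\ play n x) -> False.
Proof.
move=> fx0 /choice[xs hxs].
have [[c Ec] Ecl] := E_compact.
pose cK k := maxn (cR k./2) (c k./2).
have Kc u b : K u b -> forall k, (b k <= cK k)%N.
  move=> [kr ke] k; rewrite -(bpairK b) /bpair /cK; case: ifP => _.
    by apply: leq_trans (leq_maxr _ _); apply: Ec ke _.
  by apply: leq_trans (leq_maxl _ _); apply: tame_bounded R_tame _ _ kr _.
(* All answers of a play are packed into one bounded point of Baire space, with coordinate [k] of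
   the answer to query [i] stored at [pickle (i, k)]; a single cluster point then serves all
   rounds. *)
pose cc m : nat := if (unpickle m : option (nat * nat)) is Some (_, k) then cK k else 0%N.
pose bs n : baire := fun m =>
  if (unpickle m : option (nat * nat)) is Some (i, k) then (if (i < n)%N then xs n i.+1 k else 0%N)
  else 0%N.
have bsc n m : (bs n m <= cc m)%N.
  rewrite /bs /cc; case: (unpickle m) => // -[i k]; case: ifP => // iltn.
  by apply: Kc; apply: ((hxs n).2.2 _ iltn).2.
have [b hb] := cluster_point bsc.
pose x (i : nat) : baire := if i is i'.+1 then fun k => b (pickle (i', k)) else x0.
have near n M N : exists m, [/\ (N <= m)%N, hist_agree n M x (xs m) & play m (xs m)].
  (* Agreement up to [B] covers the first [M] coordinates of the first [n] answers. *)
  pose B := (\max_(i < n) \max_(k < M) pickle (i : nat, k : nat)).+1.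
  have hB i k : (i < n)%N -> (k < M)%N -> (pickle (i, k) < B)%N.
    move=> ni kM; rewrite ltnS.
    apply: leq_trans (leq_bigmax (Ordinal ni)).
    exact: (leq_bigmax (F := fun k : 'I_M => pickle (i, k : nat)) (Ordinal kM)).
  have [m Nm /= bm] := hb B (maxn N (maxn n M)).
  exists m; split; [lia| |exact: (hxs m).2].
  move=> [_|i ni] k kM /=.
    by apply: (agreeW _ (hxs m).1 kM); lia.
  rewrite bm ?hB// /bs pickleK; case: ifP => //; lia.
apply: (no_infinite_play W K_sub (x := x)); elim=> [|n IHn].
  by split => //=.
have [q|[_ r1 _]] := Kplay_next W K_sub IHn; last first.
  have [M _ hM] := Kplay_cont W K_sub 0 IHn.
  have [m [nm xm pm]] := near n M n.+1.
  have [r1' _] := hM _ (KplayW (ltnW nm) pm) xm.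
  by have [[_ r2 _] _] := pm.2 _ nm; rewrite -r1' r1 in r2.
apply: KplayS => //.
have hap M : exists u' b', [/\ agree M (rep n x).2 u', agree M (x n.+1) b' & K u' b'].
  have [M' MM' hM'] := Kplay_cont W K_sub M IHn.
  have [m [nm xm pm]] := near n.+1 M' n.+1.
  exists (rep n (xs m)).2, (xs m n.+1); split; last exact: (pm.2 _ nm).2.
    apply: (hM' _ (KplayW (ltnW nm) pm) _).2.
    by move=> i ni; apply: xm; apply: leqW.
  by apply: agreeW MM' (xm _ _).
have [_ _ dq] := q.
split.
  apply: tame_closed R_tame _ _ (dom_l dq) _ => M.
  have [u' [b' [h1 h2 [h3 _]]]] := hap M.*2.
  by exists (bfst u'), (bfst b'); split => //; apply: agree_bfst.
apply: Ecl (dom_r dq) _ => M.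
have [u' [b' [h1 h2 [_ h3]]]] := hap M.*2.
by exists (bsnd u'), (bsnd b'); split => //; apply: agree_bsnd.
Qed.

Theorem tame_times_compact_false :
  H setT -> (forall s, hard_at f Phi H s) ->
  (forall s, evt0 s -> dom f (Phi s)) -> False.
Proof.
move=> HT f_hard fdom.
have zz : evt0 zero_seq by exists 0%N.
have An n : approachable n.
  elim: n => [r M|n /(approachableS f_hard)//].
  exists zero_seq, (fun=> Phi zero_seq); split => //.
  exact: Big_start.
apply: (@limit_play (Phi zero_seq)); first exact: fdom.
move=> n; have [s [x [ns [x0 px]]]] := An n 0%N n.
by exists x; split => //; rewrite x0; apply: Phi_lip.
Qed.

(* If O always holds, the position never has to be moved, so that one level of
   branching above the fixed instance Phi zero_seq suffices. *)
Theorem continuous_times_compact_false :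
  (forall u, dom gR u -> O u) -> hard_at f Phi H zero_seq ->
  dom f (Phi zero_seq) ->
  H [set j | forall M, exists s', [/\ branch zero_seq j s', agree M zero_seq s'
                                    & dom f (Phi s')]] -> False.
Proof.
move=> allO f_hard f0 Hs.
have step n x : Big H n (position n) 1 zero_seq x ->
    exists b, Big H n.+1 (position n.+1) 1 zero_seq (upd x n.+1 b).
  move=> Bx; have qx := Big_queries f_hard Bx.
  have Bq : Big H n (fun s x => (position n s x /\ quer n x) /\
                                O (bfst (rep n x).2)) 1 zero_seq x.
    have [px Hx] := Bx; split.
      by split => //; apply: allO; apply: dom_l; case: qx.
    apply: H_up Hx => j h M.
    have [M1 _ hM1] := Kplay_cont W K_sub 0 px.2.
    have [s' [y [b1 b2 b3 py]]] := h (maxn M M1).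
    have [r1 _] := hM1 _ py.2 (hist_agreeW (leq_maxr _ _) b3).
    have qy : quer n y.
      have [//|[_ r2 _]] := Kplay_next W K_sub py.2.
      by have [_ r3 _] := qx; rewrite -r1 r3 in r2.
    exists s', y; split => //.
    - exact: agreeW (leq_maxl _ _) b2.
    - exact: hist_agreeW (leq_maxl _ _) b3.
    - by split => //; apply: allO; apply: dom_l; case: qy.
  have dq : dom gR (bfst (rep n x).2) by apply: dom_l; case: qx.
  have [z Sz] := tame_exS R_tame dq (allO _ dq).
  have [e _ hB] := Big_answer (tame_S R_tame) (tame_lsc R_tame) Bq Sz.
  by exists (bpair z e).
have [nxt hnxt] := choice (fun nx : nat * (nat -> baire) =>
  (let: (n, x) as nx := nx return exists b : baire,
     Big H nx.1 (position nx.1) 1 zero_seq nx.2 ->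
     Big H nx.1.+1 (position nx.1.+1) 1 zero_seq (upd nx.2 nx.1.+1 b)
   in match pselect (Big H n (position n) 1 zero_seq x) with
      | left h => let: ex_intro b hb := step n x h in ex_intro _ b (fun=> hb)
      | right nh => ex_intro _ zero_seq (fun h => False_ind _ (nh h)) end)).
pose xs := fix xs n := if n is m.+1 then upd (xs m) m.+1 (nxt (m, xs m))
                       else (fun=> Phi zero_seq).
have Bxs n : Big H n (position n) 1 zero_seq (xs n).
  elim: n => [|n IH]; last exact: (hnxt (n, xs n)).
  split; first by split.
  apply: H_up Hs => j h M; have [s' [b1 b2 fs']] := h M.
  exists s', (fun=> Phi s'); split => // i _; exact: Phi_lip.
have xsE n m i : (i <= n)%N -> (n <= m)%N -> xs m i = xs n i.
  move=> ni; elim: m => [|m IH]; first by rewrite leqn0 => /eqP->.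
  rewrite leq_eqVlt => /orP[/eqP->//|nm].
  by rewrite /= upd_lt ?IH//; lia.
apply: (no_infinite_play W K_sub (x := fun i => xs i i)) => n.
have [[_ pn] _] := Bxs n.
by apply: (Kplay_ext W _ pn) => i ni; rewrite (xsE i n).
Qed.

End tame_times_compact.

(** * Generic answers to DML and DNE *)

(* (rho, m) stands for the cylinder of the sequences that agree with rho
   below m. *)
Definition subcyl (rho' : baire) (m' : nat) (rho : baire) (m : nat) :=
  (m <= m')%N /\ agree m rho rho'.

Lemma subcyl_refl rho m : subcyl rho m rho m.
Proof. by []. Qed.

Lemma subcyl_trans r1 m1 r2 m2 r3 m3 :
  subcyl r1 m1 r2 m2 -> subcyl r2 m2 r3 m3 -> subcyl r1 m1 r3 m3.
Proof.
move=> [m12 a12] [m23 a23]; split; first exact: leq_trans m12.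
by apply: agree_trans a23 _; apply: agreeW a12.
Qed.

Lemma subcyl_agree r1 m1 r2 m2 s :
  subcyl r1 m1 r2 m2 -> agree m1 r1 s -> agree m2 r2 s.
Proof.
by move=> [m12 a12] s1; apply: agree_trans a12 _; apply: agreeW s1.
Qed.

Definition nwd (N : set baire) := forall rho m, exists rho' m',
  subcyl rho' m' rho m /\ forall s, agree m' rho' s -> ~ N s.

Lemma nwdU (A B : set baire) : nwd A -> nwd B -> nwd (A `|` B).
Proof.
move=> nA nB rho m; have [r1 [m1 [c1 h1]]] := nA rho m.
have [r2 [m2 [c2 h2]]] := nB r1 m1; exists r2, m2; split.
  exact: subcyl_trans c1.
by move=> s sr [As|]; [exact: h1 (subcyl_agree c2 sr) As|exact: h2].
Qed.

Lemma nwd_in (A : set baire) rho m : (forall s, A s -> agree m rho s) ->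
  (forall r k, subcyl r k rho m -> exists r' k', subcyl r' k' r k /\
    forall s, agree k' r' s -> ~ A s) -> nwd A.
Proof.
move=> Am h r k; have [rr|nrr] := pselect (agree m rho r).
  have [|r' [k' [c' h']]] := h r (maxn k m); first by split=> //; lia.
  exists r', k'; split => //; apply: subcyl_trans c' _; split => //; lia.
exists r, (maxn k m); split; first by split => //; lia.
move=> s rs As; apply: nrr; apply: agree_trans (Am _ As) _.
by apply: agree_sym; apply: agreeW rs; lia.
Qed.

Lemma nwd_avoid (N : nat -> set baire) n rho m : (forall k, nwd (N k)) ->
  exists rho' m', subcyl rho' m' rho m /\
    forall k s, (k < n)%N -> agree m' rho' s -> ~ N k s.
Proof.
move=> Nn; elim: n => [|n [r1 [m1 [c1 h1]]]]; first by exists rho, m.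
have [r2 [m2 [c2 h2]]] := Nn n r1 m1; exists r2, m2; split.
  exact: subcyl_trans c1.
move=> k s; rewrite ltnS leq_eqVlt => /orP[/eqP->|kn] sr; first exact: h2.
by apply: h1 (subcyl_agree c2 sr).
Qed.

Lemma cyl_limit (r : nat -> baire) (m : nat -> nat) :
  (forall k, (k <= m k)%N) ->
  (forall k, subcyl (r k.+1) (m k.+1) (r k) (m k)) ->
  exists s, forall k, agree (m k) (r k) s.
Proof.
move=> km c.
have cc k l : (k <= l)%N -> subcyl (r l) (m l) (r k) (m k).
  elim: l => [|l IH]; first by rewrite leqn0 => /eqP->.
  rewrite leq_eqVlt => /orP[/eqP->//|kl]; apply: subcyl_trans (c l) (IH kl).
(* Coordinate [i] is settled by cylinder number [i.+1], as [i < m i.+1]. *)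
exists (fun i => r i.+1 i) => k i im.
have [ki|ik] := leqP k i.
  by have [_ ->] := cc k i.+1 (leqW ki).
by have [_ ->//] := cc i.+1 k ik; apply: km.
Qed.

Lemma baire_category (N : nat -> set baire) rho m : (forall k, nwd (N k)) ->
  exists2 s, agree m rho s & forall k, ~ N k s.
Proof.
move=> Nn.
have stepE (p : nat * (baire * nat)) : exists q : baire * nat,
    [/\ subcyl q.1 q.2 p.2.1 p.2.2, (p.1 < q.2)%N &
        forall s, agree q.2 q.1 s -> ~ N p.1 s].
  have [r [k [c h]]] := Nn p.1 p.2.1 (maxn p.2.2 p.1.+1).
  exists (r, k) => /=; split => //; last by case: c; lia.
  by apply: subcyl_trans c _; split => //; lia.
have [nxt hnxt] := choice stepE.
pose rm := fix rm k := if k is l.+1 then nxt (l, rm l) else (rho, m).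
have [|k|s hs] := @cyl_limit (fun k => (rm k).1) (fun k => (rm k).2).
- by case=> // k; have [_ /=] := hnxt (k, rm k).
- by have [] := hnxt (k, rm k).
exists s; first exact: (hs 0%N).
by move=> k; have [_ _] := hnxt (k, rm k); apply; apply: (hs k.+1).
Qed.

(** Otherwise the generic points of each [C a] form a nowhere dense set, and these sets together
    with [N] would exhaust the cylinder. *)
Lemma category_cover (N C : nat -> set baire) rho m : (forall k, nwd (N k)) ->
  (forall s, agree m rho s -> (forall k, ~ N k s) -> exists a, C a s) ->
  exists a r k, subcyl r k rho m /\ forall r' k', subcyl r' k' r k ->
    exists s, [/\ agree k' r' s, forall l, ~ N l s & C a s].
Proof.
move=> Nn NC; apply: contrapT => hn.
pose N' a : set baire := [set s | [/\ agree m rho s, forall l, ~ N l s & C a s]].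
have N'n a : nwd (N' a).
  apply: (@nwd_in _ rho m) => [s []//|r k c].
  apply: contrapT => hr; apply: hn; exists a, r, k; split => // r' k' c'.
  apply: contrapT => hs; apply: hr; exists r', k'; split => // s rs [h1 h2 h3].
  by apply: hs; exists s.
have [s rs hs] := @baire_category (fun k => N k `|` N' k) rho m
  (fun k => nwdU (Nn k) (N'n k)).
have sN k : ~ N k s by move=> Nk; apply: (hs k); left.
by have [a Ca] := NC s rs sN; apply: (hs a); right.
Qed.

Lemma least_nat (A : set nat) : A !=set0 ->
  exists2 v, A v & forall w, A w -> (v <= w)%N.
Proof.
move=> [a Aa]; have ex : exists v, `[< A v >] by exists a; apply/asboolP.
case: (ex_minnP ex) => v /asboolP Av hv; exists v => // w Aw.
by apply: hv; apply/asboolP.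
Qed.

(** Since [B] is arbitrary, [e] is only a limit of its elements; [Bk k] keeps those whose first [k]
    entries are successively least. *)
Lemma lexmin_exists (B : set baire) : B !=set0 -> exists e : baire,
  (forall k, exists2 b, B b & agree k e b) /\
  (forall k b, B b -> agree k e b -> (e k <= b k)%N).
Proof.
move=> B0.
pose Bk := fix Bk k := if k is l.+1
  then [set b | Bk l b /\ forall b' : baire, Bk l b' -> (b l <= b' l)%N] else B.
have Bk0 k : Bk k !=set0.
  elim: k => [//|k [b Bb]].
  have [|_ [b' Bb' <-] hb'] := @least_nat [set (b : baire) k | b in Bk k].
    by exists (b k); exists b.
  by exists b'; split => // b1 Bb1; apply: hb'; exists b1.
have [wit hwit] := choice Bk0.
pose e : baire := fun k => wit k.+1 k.
have BkS k b : Bk k.+1 b -> b k = e k.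
  move=> [h1 h2]; have [h3 h4] := hwit k.+1.
  by apply/eqP; rewrite eqn_leq; apply/andP; split; [exact: h2 (wit k.+1) h3|exact: h4 b h1].
have BkB k b : Bk k b -> B b /\ agree k e b.
  elim: k b => [|k IH] b hb; first by split.
  have [h1 _] := hb; have [h2 h3] := IH _ h1; split => //.
  by apply: agreeS h3 _; rewrite (BkS _ _ hb).
have BBk k b : B b -> agree k e b -> Bk k b.
  move=> Bb; elim: k => [//|k IH] ekb.
  have Bkb := IH (agreeW (leqnSn k) ekb); split => // b' Bb'.
  by have [_ h] := hwit k.+1; rewrite -ekb//; apply: h.
exists e; split => k; first by have [Bw ew] := BkB _ _ (hwit k); exists (wit k).
move=> b Bb ekb; have [_ h] := hwit k.+1; apply: h; exact: BBk.
Qed.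

(* The lexicographically least answer is semicontinuous in the instance, hence
   continuous on a comeager set. *)
Lemma generic_selection (E : multifun) (N : nat -> set baire) rho m
    (w : baire -> baire) : compact_pb E -> (forall k, nwd (N k)) ->
  let Y s := agree m rho s /\ forall k, ~ N k s in
  (forall s, Y s -> dom E (w s)) ->
  (forall s M, Y s -> exists M', forall s', Y s' -> agree M' s s' ->
     agree M (w s) (w s')) ->
  exists (N' : nat -> set baire) (e : baire -> baire),
    [/\ forall k, nwd (N' k), forall k, N k `<=` N' k,
        forall s, Y s -> E (w s) (e s)
      & forall s, agree m rho s -> (forall k, ~ N' k s) -> forall M,
        exists M', forall s', Y s' -> agree M' s s' -> agree M (e s) (e s')].
Proof.
move=> [[c Ec] Ecl] Nn Y wE wc.
have lexmin s : exists es : baire, Y s ->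
    (forall k, exists2 b, E (w s) b & agree k es b) /\
    (forall k b, E (w s) b -> agree k es b -> (es k <= b k)%N).
  have [Ys|] := pselect (Y s); last by exists zero_seq.
  by have [es hes] := @lexmin_exists (E (w s)) (wE _ Ys); exists es.
have [e he] := choice lexmin.
have Ee s : Y s -> E (w s) (e s).
  move=> Ys; apply: Ecl; first exact: wE.
  by move=> M; have [b Eb eb] := (he _ Ys).1 M; exists (w s), b.
(* Upper semicontinuity of the solution sets: bad solutions at nearby instances would cluster at a
   solution of [w s]. *)
have usc s k : Y s -> exists M, forall s', Y s' -> agree M s s' ->
    forall b', E (w s') b' -> exists2 b, E (w s) b & agree k b b'.
  move=> Ys; apply: contrapT => hn.
  pose P M (b' : baire) := exists s', [/\ Y s', agree M s s', E (w s') b' &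
    forall b, E (w s) b -> ~ agree k b b'].
  have PW M M' b : (M <= M')%N -> P M' b -> P M b.
    by move=> MM' [s' [h1 h2 h3 h4]]; exists s'; split => //; apply: agreeW h2.
  have Pex M : exists2 b, P M b & forall k, (b k <= c k)%N.
    apply: contrapT => hM; apply: hn; exists M => s' Ys' ss' b' Eb'.
    apply: contrapT => hb; apply: hM; exists b'; last exact: Ec Eb'.
    by exists s'; split => // b Eb kb; apply: hb; exists b.
  have [b0 hb0] := compactness PW Pex.
  have Eb0 : E (w s) b0.
    apply: Ecl; first exact: wE.
    move=> M; have [M' hM'] := wc s M Ys.
    have [b [s' [h1 h2 h3 _]] bb] := hb0 (maxn M M').
    exists (w s'), b; split => //; last exact: agreeW (leq_maxl _ _) bb.
    by apply: hM' => //; exact: agreeW (leq_maxr _ _) h2.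
  have [b [s' [_ _ _ h4]] bb] := hb0 k; exact: h4 Eb0 bb.
(* Every subcylinder contains one on which the first [k] entries of [e] are constant over [Y]. *)
have loc k r l : subcyl r l rho m -> exists r' l', subcyl r' l' r l /\
    forall s s', Y s -> Y s' -> agree l' r' s -> agree l' r' s' ->
      agree k (e s) (e s').
  elim: k r l => [|k IH] r l cr; first by exists r, l.
  have [r1 [l1 [c1 h1]]] := IH r l cr.
  have c1m := subcyl_trans c1 cr.
  (* With the earlier entries fixed, entry [k] of the least solution can only increase near [s]. An
     [s] with [e s k] maximal, that is with [c k - e s k] minimal, makes it constant. *)
  pose A := [set (c k - e s k)%N | s in [set s | Y s /\ agree l1 r1 s]].
  have [|_ [s [Ys rs] <-] smax] := @least_nat A.
    have [s rs Ns] := baire_category r1 l1 Nn.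
    exists (c k - e s k)%N; exists s => //; split => //; split => //.
    exact: subcyl_agree rs.
  have [M hM] := usc s k.+1 Ys.
  exists s, (maxn l1 M); split.
    by apply: subcyl_trans c1; split => //; exact: leq_maxl.
  have key s' : Y s' -> agree (maxn l1 M) s s' -> agree k.+1 (e s) (e s').
    move=> Ys' ss'.
    have rs' : agree l1 r1 s'.
      by apply: agree_trans rs _; apply: agreeW ss'; apply: leq_maxl.
    have ee := h1 _ _ Ys Ys' rs rs'; apply: (agreeS ee _).
    have [||b Eb be] := hM s' Ys' _ (e s') => //.
    - by apply: agreeW ss'; apply: leq_maxr.
    - exact: Ee.
    have := (he _ Ys).2 k b Eb; rewrite be// => /(_ _) h.
    have h2 : (e s k <= e s' k)%N.
      by apply: h => i ik; rewrite ee// be//; lia.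
    have := smax (c k - e s' k)%N (ex_intro2 _ _ s' (conj Ys' rs') erefl).
    have := Ec _ _ (Ee _ Ys) k; have := Ec _ _ (Ee _ Ys') k; lia.
  move=> s1 s2 Y1 Y2 a1 a2; apply: agree_trans (key _ Y2 a2).
  by apply: agree_sym; exact: key.
pose N1 k : set baire := [set s | Y s /\ ~ exists M, forall s', Y s' ->
  agree M s s' -> agree k (e s) (e s')].
have N1n k : nwd (N1 k).
  apply: (@nwd_in _ rho m) => [s [[]]//|r l cr].
  have [r' [l' [c' h']]] := loc k r l cr; exists r', l'; split => //.
  move=> s rs [Ys]; apply; exists l' => s' Ys' ss'; apply: h' => //.
  exact: agree_trans ss'.
exists (fun k => N k `|` N1 k), e; split => //.
- by move=> k; apply: nwdU.
move=> s rs Ns M.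
have Ys : Y s by split => // k Nk; apply: (Ns k); left.
by apply: contrapT => h; apply: (Ns M); right.
Qed.

Lemma binary_not_Sigma2 p : binary_phi p -> ~ Sigma2 p ->
  forall a, exists b, phi_of p a b = 0%N.
Proof.
move=> bp nS a; apply: contrapT => h; apply: nS; exists a => b.
have := bp a b; case E0 : (phi_of p a b) => [|[|]]// _.
by case: h; exists b.
Qed.

(** * The game against [DML_pb], [DNE_pb] and a compact problem *)

Section generic_game.
Variables (f E : multifun) (Phi : baire -> baire) (H : set (set nat)).
Hypothesis H_up : up_closed H.
Hypothesis H_ne : forall A, H A -> A !=set0.
Hypothesis H_T : H setT.
Hypothesis Phi_lip : prefix_monotone Phi.
Hypothesis f_dom : forall s, dom f (Phi s).
Hypothesis f_hard : forall s, hard_at f Phi H s.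
Hypothesis E_compact : compact_pb E.
Hypothesis E_regular : partition_regular E H.
Variables (sd : nat -> (nat -> baire) -> Prop).
Variables (rep : nat -> (nat -> baire) -> bool * baire).
Let g := mprod (mprod DML_pb DNE_pb) E.
Hypothesis W : winning f g sd rep.

Let play n x := Kplay f g sd rep g n x.
Let quer n x := queries g sd rep n x.
Let gg : forall u b, g u b -> g u b. Proof. by []. Qed.

Definition generic (N : nat -> set baire) (s : baire) := forall k, ~ N k s.

Definition Dpt n (N : nat -> set baire) (alpha : baire -> nat -> baire) s x :=
  [/\ x 0%N = Phi s, play n x &
    H [set j | forall M, exists s', [/\ branch s j s', agree M s s',
      generic N s' & hist_agree n M x (alpha s')]]].

(* alpha s is the position reached after n rounds on the instance Phi s, for
   generic s.  The eventually zero sequences need not be generic: they are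
   only required to have a position that is a limit of generic ones. *)
Record stage n rho m N alpha : Prop := Stage {
  stage_nwd : forall k, nwd (N k) ;
  stage_play : forall s, agree m rho s -> generic N s ->
    alpha s 0%N = Phi s /\ play n (alpha s) ;
  stage_cont : forall s M, agree m rho s -> generic N s -> exists M',
    forall s', agree m rho s' -> generic N s' -> agree M' s s' ->
    hist_agree n M (alpha s) (alpha s') ;
  stage_dense : forall r k, subcyl r k rho m -> exists s x,
    agree k r s /\ Dpt n N alpha s x }.

(** By category, a generic point on a branch can be replaced by one avoiding the larger family [N'],
    so close that the branching entry and, approximately, the position are kept. *)
Lemma Dpt_refine n rho m N N' alpha s x : stage n rho m N alpha ->
  (forall k, nwd (N' k)) -> (forall k, N k `<=` N' k) ->
  agree m rho s -> Dpt n N alpha s x -> Dpt n N' alpha s x.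
Proof.
move=> st Nn NN' ms [x0 px Hx]; split => //; apply: H_up Hx => j /= h M.
have [s1 [[m0 [b1 b2 b3]] ss1 g1 xs1]] := h (maxn m M).
have ms1 : agree m rho s1.
  by apply: agree_trans ms _; apply: agreeW ss1; apply: leq_maxl.
have [M1 hM1] := stage_cont st M ms1 g1.
have [s2 s12 g2] := baire_category s1 (maxn (maxn M M1) (maxn m m0.+1)) Nn.
have g2' : generic N s2 by move=> k Nk; apply: (g2 k); apply: NN'.
exists s2; split => //.
- exists m0; split => //; last by rewrite -b2 s12//; lia.
  by apply: agree_trans b1 _; apply: agreeW s12; lia.
- apply: agree_trans (agreeW (leq_maxr _ _) ss1) _; apply: agreeW s12; lia.
- apply: hist_agree_trans (hist_agreeW (leq_maxr _ _) xs1) _.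
  apply: hM1 => //; last by apply: agreeW s12; lia.
  by apply: agree_trans ms1 _; apply: agreeW s12; lia.
Qed.

Lemma stage_restrict n rho m N rho' m' N' alpha : stage n rho m N alpha ->
  subcyl rho' m' rho m ->
  (forall k, nwd (N' k)) -> (forall k, N k `<=` N' k) ->
  stage n rho' m' N' alpha.
Proof.
move=> st c Nn NN'.
have gN s : generic N' s -> generic N s.
  by move=> gs k Nk; apply: (gs k); apply: NN'.
split => //.
- by move=> s ms /gN gs; apply: (stage_play st) gs; apply: subcyl_agree ms.
- move=> s M ms /gN gs.
  have [M' hM'] := stage_cont st M (subcyl_agree c ms) gs.
  exists M' => s' ms' /gN gs'; apply: hM' => //; exact: subcyl_agree ms'.
- move=> r k cr; have [s [x [rs Ds]]] := stage_dense st (subcyl_trans cr c).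
  exists s, x; split => //; apply: (Dpt_refine st) Ds => //.
  exact: subcyl_agree (subcyl_trans cr c) rs.
Qed.

Lemma Dpt_queries n rho m N alpha s x : stage n rho m N alpha ->
  agree m rho s -> Dpt n N alpha s x -> quer n x.
Proof.
move=> st ms [x0 px Hx].
have [//|[sx r1 fx]] := Kplay_next W gg px.
rewrite x0 in fx; have [j /= hj [M hM]] := f_hard Hx fx.
have [M' MM' hM'] := Kplay_cont W gg M px.
have [s' [b1 b2 g' b3]] := hj (maxn m M').
have ms' : agree m rho s'.
  by apply: agree_trans ms _; apply: agreeW b2; apply: leq_maxl.
have [a0 pa] := stage_play st ms' g'.
have [r1' r2'] := hM' _ pa (hist_agreeW (leq_maxr _ _) b3).
have [[_ q1 _]|[_ _ fy]] := Kplay_next W gg pa.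
  by rewrite -r1' r1 in q1.
by case: (hM s' (rep n (alpha s')).2 b1); rewrite -?a0.
Qed.

Lemma Dpt_limit n rho m N alpha s x M : stage n rho m N alpha ->
  agree m rho s -> Dpt n N alpha s x -> exists s', [/\ agree m rho s',
    generic N s', agree M s s', (rep n x).1 = (rep n (alpha s')).1 &
    agree M (rep n x).2 (rep n (alpha s')).2].
Proof.
move=> st ms [x0 px Hx].
have [M' MM' hM'] := Kplay_cont W gg M px.
have [j hj] := H_ne Hx.
have [s' [b1 b2 g' b3]] := hj (maxn m M').
have ms' : agree m rho s'.
  by apply: agree_trans ms _; apply: agreeW b2; apply: leq_maxl.
have [a0 pa] := stage_play st ms' g'.
have [r1' r2'] := hM' _ pa (hist_agreeW (leq_maxr _ _) b3).
by exists s'; split => //; apply: agreeW b2; lia.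
Qed.

Lemma stage_rep_cont n rho m N alpha s M : stage n rho m N alpha ->
  agree m rho s -> generic N s -> exists M', forall s', agree m rho s' ->
  generic N s' -> agree M' s s' ->
  (rep n (alpha s)).1 = (rep n (alpha s')).1 /\
  agree M (rep n (alpha s)).2 (rep n (alpha s')).2.
Proof.
move=> st ms gs; have [_ pa] := stage_play st ms gs.
have [M1 _ hM1] := Kplay_cont W gg M pa.
have [M2 hM2] := stage_cont st M1 ms gs.
exists M2 => s' ms' gs' ss'; apply: hM1; last exact: hM2.
exact: (stage_play st ms' gs').2.
Qed.

(** At a limit point hardness forces a query; this passes to some generic point near it, and by
    continuity to all generic points of a cylinder. *)
Lemma stage_queries n rho m N alpha : stage n rho m N alpha ->
  exists rho' m', subcyl rho' m' rho m /\
    forall s, agree m' rho' s -> generic N s -> quer n (alpha s).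
Proof.
move=> st; have [s [x [ms Ds]]] := stage_dense st (subcyl_refl rho m).
have [_ r1 _] := Dpt_queries st ms Ds.
have [s' [ms' gs' _ r1' _]] := Dpt_limit 0 st ms Ds.
have [M hM] := stage_rep_cont 0 st ms' gs'.
have c : subcyl s' (maxn m M) rho m by split => //; apply: leq_maxl.
exists s', (maxn m M); split => // s2 ms2 gs2.
have ms2' := subcyl_agree c ms2.
have [r2 _] := hM s2 ms2' gs2 (agreeW (leq_maxr _ _) ms2).
have [_ pa] := stage_play st ms2' gs2.
have [//|[_ r3 _]] := Kplay_next W gg pa.
by rewrite -r2 -r1' r1 in r3.
Qed.

(** Being 1 at given coordinates of the query is a closed condition, so it extends from a dense set
    of generic points to all of them. *)
Lemma stage_dense_closed n rho m N alpha (h : nat -> nat) r k :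
  stage n rho m N alpha -> subcyl r k rho m ->
  (forall r' k', subcyl r' k' r k -> exists s, [/\ agree k' r' s, generic N s &
     forall b, (rep n (alpha s)).2 (h b) = 1%N]) ->
  forall s, agree k r s -> generic N s ->
  forall b, (rep n (alpha s)).2 (h b) = 1%N.
Proof.
move=> st c hd s rs gs b.
have [M hM] := stage_rep_cont (h b).+1 st (subcyl_agree c rs) gs.
have [|s' [ss' gs' hs']] := hd s (maxn k M).
  by split => //; apply: leq_maxl.
have rs' : agree k r s'.
  by apply: agree_trans rs _; apply: agreeW ss'; apply: leq_maxl.
have [_ ->//] := hM s' (subcyl_agree c rs') gs' (agreeW (leq_maxr _ _) ss').
Qed.

Let posDNE (p : nat) := p.*2.+1.*2.

(** Every generic instance has a witness; by category one [a] is a witness densely often in a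
    subcylinder, hence at all its generic points. *)
Lemma stage_DNE n rho m N alpha : stage n rho m N alpha ->
  (forall s, agree m rho s -> generic N s -> quer n (alpha s)) ->
  exists a rho' m', subcyl rho' m' rho m /\
    forall s, agree m' rho' s -> generic N s -> forall b,
      phi_of (bsnd (bfst (rep n (alpha s)).2)) a b = 1%N.
Proof.
move=> st q.
have [|a [r [k [c h]]]] := @category_cover N (fun a s => forall b,
    phi_of (bsnd (bfst (rep n (alpha s)).2)) a b = 1%N) rho m (stage_nwd st).
  move=> s ms gs; have [_ _ [b [[_ [_ Sb _]] _]]] := q s ms gs.
  by have [a ha] := Sb; exists a.
exists a, r, k; split => //.
exact: (@stage_dense_closed _ _ _ _ _ (fun b => posDNE (pickle (a, b))) _ _ st c).
Qed.

Let DML_false (i : nat) (u : baire) :=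
  let p := bfst (bfst u) in
  forall a, exists b, phi_of (if i == 0%N then bfst p else bsnd p) a b = 0%N.

(** The answer [i] must be right at generic points and at a dense set of limit points. The second
    does not follow from the first, as falsity of a Sigma^0_2 statement does not pass to limits. *)
Lemma stage_DML n rho m N alpha : stage n rho m N alpha ->
  (forall s, agree m rho s -> generic N s -> quer n (alpha s)) ->
  exists i rho' m' N', [/\ (i < 2)%N, subcyl rho' m' rho m,
    forall k, nwd (N' k), forall k, N k `<=` N' k &
    (forall s, agree m' rho' s -> generic N' s ->
       DML_false i (rep n (alpha s)).2) /\
    (forall r k, subcyl r k rho' m' -> exists s x, [/\ agree k r s,
       Dpt n N' alpha s x & DML_false i (rep n x).2])].
Proof.
move=> st q.
pose side (i : nat) (u : baire) : baire :=
  let p := bfst (bfst u) in if i == 0%N then bfst p else bsnd p.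
pose pos (i a b : nat) : nat :=
  if i == 0%N then (pickle (a, b)).*2.*2.*2 else (pickle (a, b)).*2.+1.*2.*2.
have sideE i u a b : phi_of (side i u) a b = u (pos i a b).
  by rewrite /side /pos; case: eqP.
have excl u : dom g u -> forall i, (i < 2)%N -> Sigma2 (side (1 - i)%N u) ->
    DML_false i u.
  move=> [w [[[[b0 b1] nS _ _] _] _]] [|[|]]// _ S1.
  - by apply: binary_not_Sigma2 => // S0; apply: nS.
  - by apply: binary_not_Sigma2 => // S0; apply: nS.
pose forced i a r k := forall s, agree k r s -> generic N s ->
    forall b, (rep n (alpha s)).2 (pos i a b) = 1%N.
(* A witness [a] for side [i] that is forced on a cylinder is also one at the limit points there, so
   the other side is the right answer throughout. *)
have [[i [a [r [k [i2 c hf]]]]]|nf] := pselect (exists i a r k,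
    [/\ (i < 2)%N, subcyl r k rho m & forced i a r k]).
  exists (1 - i)%N, r, k, N.
  have i2' : (1 - i < 2)%N by lia.
  have ii : (1 - (1 - i) = i)%N by lia.
  split; [exact: i2'|exact: c|exact: stage_nwd st|by move=> l s'|].
  split.
    move=> s rs gs; have [_ _ dq] := q s (subcyl_agree c rs) gs.
    apply: (excl _ dq) => //; rewrite ii; exists a => b.
    by rewrite sideE; apply: hf.
  move=> r1 k1 c1; have c1m := subcyl_trans c1 c.
  have [s [x [rs Ds]]] := stage_dense st c1m.
  have ms := subcyl_agree c1m rs.
  exists s, x; split => //; have [_ _ dq] := Dpt_queries st ms Ds.
  apply: (excl _ dq) => //; rewrite ii; exists a => b; rewrite sideE.
  have [s' [ms' gs' ss' _ r2]] := Dpt_limit (maxn k (pos i a b).+1) st ms Ds.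
  rewrite r2 ?leq_maxr//; apply: hf => //.
  apply: agree_trans (subcyl_agree c1 rs) _.
  by apply: agreeW ss'; apply: leq_maxl.
(* As nothing is forced, each witness for side [i] works on a nowhere dense set only; removing these
   sets makes the statement of side [i] false at all generic points. *)
pose Nf i a : set baire := [set s | [/\ agree m rho s, generic N s &
  forall b, (rep n (alpha s)).2 (pos i a b) = 1%N]].
have Nfn i a : (i < 2)%N -> nwd (Nf i a).
  move=> i2; apply: (@nwd_in _ rho m) => [s []//|r k c].
  apply: contrapT => hr; apply: nf; exists i, a, r, k; split => //.
  apply: (stage_dense_closed st c) => r' k' c'.
  apply: contrapT => hs; apply: hr; exists r', k'; split => // s rs [h1 h2 h3].
  by apply: hs; exists s.
have fin i r k : (i < 2)%N -> subcyl r k rho m ->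
    (forall r' k', subcyl r' k' r k -> exists s x, [/\ agree k' r' s,
       Dpt n N alpha s x & DML_false i (rep n x).2]) ->
    exists i rho' m' N', [/\ (i < 2)%N, subcyl rho' m' rho m,
    forall k, nwd (N' k), forall k, N k `<=` N' k &
    (forall s, agree m' rho' s -> generic N' s ->
       DML_false i (rep n (alpha s)).2) /\
    (forall r k, subcyl r k rho' m' -> exists s x, [/\ agree k r s,
       Dpt n N' alpha s x & DML_false i (rep n x).2])].
  move=> i2 c hd.
  have nwd' l : nwd (N l `|` Nf i l).
    by apply: nwdU (Nfn _ _ _) => //; apply: stage_nwd st _.
  exists i, r, k, (fun l => N l `|` Nf i l); split => //.
  split.
    move=> s rs gs; have ms := subcyl_agree c rs.
    have gN : generic N s by move=> l Nl; apply: (gs l); left.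
    have [_ _ [w [[[[b0 b1] _ _ _] _] _]]] := q s ms gN.
    have bs : binary_phi (side i (rep n (alpha s)).2) by rewrite /side; case: eqP.
    apply: (binary_not_Sigma2 bs) => -[a ha]; apply: (gs a); right; split => //.
    by move=> b; rewrite -sideE.
  move=> r' k' c'; have [s [x [h1 h2 h3]]] := hd r' k' c'.
  exists s, x; split => //; apply: (Dpt_refine st) h2 => //.
  exact: subcyl_agree (subcyl_trans c' c) h1.
(* Side 0 is chosen if it is right at densely many limit points. Otherwise it is wrong at all limit
   points of some cylinder, so its statement holds there and side 1 is right. *)
have [h0|/existsNP[r /existsNP[k /not_implyP[c h1]]]] := pselect (forall r k,
    subcyl r k rho m -> exists s x, [/\ agree k r s,
    Dpt n N alpha s x & DML_false 0 (rep n x).2]).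
  exact: (@fin 0%N rho m).
apply: (@fin 1%N r k) => // r' k' c'.
have cm := subcyl_trans c' c.
have [s [x [rs Ds]]] := stage_dense st cm.
exists s, x; split => //.
have [_ _ dq] := Dpt_queries st (subcyl_agree cm rs) Ds.
apply: (excl _ dq) => //; apply: contrapT => nS; apply: h1.
exists s, x; split => //; first exact: subcyl_agree rs.
have [w [[[[b0 b1] _ _ _] _] _]] := dq.
exact: binary_not_Sigma2.
Qed.

Lemma stageS n rho m N alpha : stage n rho m N alpha ->
  exists rho' m' N' alpha', [/\ stage n.+1 rho' m' N' alpha',
    subcyl rho' m' rho m, forall k, N k `<=` N' k &
    forall s i, (i <= n)%N -> alpha' s i = alpha s i].
Proof.
move=> st.
have [r1 [k1 [c1 q1]]] := stage_queries st.
have {}st := stage_restrict st c1 (stage_nwd st) (fun k => @subset_refl _ (N k)).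
have [a [r2 [k2 [c2 hDNE]]]] := stage_DNE st q1.
have {q1}q2 s : agree k2 r2 s -> generic N s -> quer n (alpha s).
  by move=> /(subcyl_agree c2); apply: q1.
have {}st := stage_restrict st c2 (stage_nwd st) (fun k => @subset_refl _ (N k)).
have [i [r3 [k3 [N3 [i2 c3 N3n NN3 [hDML hdense]]]]]] := stage_DML st q2.
have gN3 s : generic N3 s -> generic N s.
  by move=> gs k Nk; apply: (gs k); apply: NN3.
have q3 s : agree k3 r3 s -> generic N3 s -> quer n (alpha s).
  by move=> /(subcyl_agree c3) rs /gN3; apply: q2.
have st3 := stage_restrict st c3 N3n NN3.
(* At generic points the answer to the [E] component is selected continuously, after enlarging the
   removed family once more. *)
have [||N4 [e [N4n N34 Ee ec]]] := @generic_selection E N3 r3 k3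
    (fun s => bsnd (rep n (alpha s)).2) E_compact N3n.
- move=> s [rs gs]; have [_ _ [b [_ Eb]]] := q3 s rs gs.
  by exists (bsnd b).
- move=> s M [rs gs]; have [M' hM'] := stage_rep_cont M.*2 st3 rs gs.
  exists M' => s' [rs' gs'] ss'; apply: agree_bsnd; exact: (hM' _ rs' gs' ss').2.
have gN4 s : generic N4 s -> generic N3 s.
  by move=> gs k Nk; apply: (gs k); apply: N34.
pose ans (b : baire) : baire := bpair (bpair (fun=> i) (fun=> a)) b.
pose alpha' s := upd (alpha s) n.+1 (ans (e s)).
have gans u b : dom g u -> DML_false i u ->
    (forall b, phi_of (bsnd (bfst u)) a b = 1%N) -> E (bsnd u) b -> g u (ans b).
  move=> [w [[[bu nS _ _] [bu2 S2 _]] _]] hi ha Eb; rewrite /g /ans.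
  by split; rewrite ?bfstK ?bsndK//; split; rewrite ?bfstK ?bsndK.
have c23 := subcyl_trans c3 c2.
exists r3, k3, N4, alpha'; split; last first.
- by move=> s l ln; rewrite /alpha' upd_lt.
- by move=> k s /NN3/N34.
- exact: subcyl_trans c23 c1.
split => //.
- move=> s rs gs; have [a0 pa] := stage_play st3 rs (gN4 _ gs).
  split; first by rewrite /alpha' upd_lt.
  have qs := q3 s rs (gN4 _ gs); apply: (Kplay_upd W) => //.
  apply: gans; [by case: qs|exact: hDML (gN4 _ gs)| |].
    by apply: hDNE; [exact: subcyl_agree rs|exact: gN3 (gN4 _ gs)].
  by apply: Ee; split => //; apply: gN4.
- move=> s M rs gs; have [M1 hM1] := stage_cont st3 M rs (gN4 _ gs).
  have [M2 hM2] := ec s rs gs M.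
  exists (maxn M1 M2) => s' rs' gs' ss' l.
  rewrite leq_eqVlt => /orP[/eqP->|ln].
    rewrite /alpha' !upd_eq; apply: agree_bpair => //; apply: hM2.
      by split => //; apply: gN4.
    by apply: agreeW ss'; apply: leq_maxr.
  rewrite /alpha' !upd_lt//; apply: hM1 => //; first exact: gN4.
  by apply: agreeW ss'; apply: leq_maxl.
- move=> r k c; have [s [x [rs Ds3 hi]]] := hdense r k c.
  exists s; have r3s := subcyl_agree c rs.
  have Ds : Dpt n N4 alpha s x by apply: (Dpt_refine st3) Ds3.
  have qx := Dpt_queries st3 r3s Ds3.
  have [x0 px Hx] := Ds; set A := [set j | _] in Hx.
  have ha b : phi_of (bsnd (bfst (rep n x).2)) a b = 1%N.
    have [s' [ms' gs' ss' _ r5]] := Dpt_limit (posDNE (pickle (a, b))).+1 st3 r3s Ds3.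
    rewrite [LHS]r5//; apply: hDNE; [exact: subcyl_agree ms'|exact: gN3].
  have [[cE Ec] Ecl] := E_compact.
  have hex j : exists ej, A j -> E (bsnd (rep n x).2) ej /\
      forall M, exists s', [/\ branch s j s', agree M s s', generic N4 s' &
        hist_agree n.+1 M (upd x n.+1 (ans ej)) (alpha' s')].
    have [Aj|nAj] := pselect (A j); last by exists zero_seq.
    (* At the limit point, a cluster point of the generic answers along direction [j] is taken;
       regularity afterwards selects one answer for a large set of directions. *)
    pose P M b := exists s', [/\ branch s j s', agree M s s', generic N4 s',
      hist_agree n M x (alpha s') & agree M (rep n x).2 (rep n (alpha s')).2] /\
      b = e s' /\ agree k3 r3 s'.
    have PW M M' b : (M <= M')%N -> P M' b -> P M b.
      move=> MM' [s' [[b1 b2 b3 b4 b5] b6]]; exists s'.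
      by split => //; split => //; [exact: agreeW b2|exact: hist_agreeW b4|
        exact: agreeW b5].
    have Pex M : exists2 b, P M b & forall l, (b l <= cE l)%N.
      have [M2 MM2 hM2] := Kplay_cont W gg M px.
      have [s' [b1 b2 gs' b4]] := Aj (maxn k3 M2).
      have rs' : agree k3 r3 s'.
        by apply: agree_trans r3s _; apply: agreeW b2; apply: leq_maxl.
      have b4' := hist_agreeW (leq_maxr _ _) b4.
      exists (e s'); last first.
        apply: (Ec (bsnd (rep n (alpha s')).2)); apply: Ee; split => //.
        exact: gN4.
      exists s'; split => //; split => //.
      - by apply: agreeW b2; lia.
      - exact: hist_agreeW b4'.
      - by apply: (hM2 _ _ b4').2; apply: (stage_play st3 rs' (gN4 _ gs')).2.
    have [ej hej] := compactness PW Pex.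
    exists ej => _; split.
      apply: Ecl; first by have [_ _ [b [_ Eb]]] := qx; exists (bsnd b).
      move=> M; have [_ [s' [[_ _ gs' _ b5] [-> rs']]] eb] := hej M.*2.
      exists (bsnd (rep n (alpha s')).2), (e s'); split.
      - exact: agree_bsnd.
      - by apply: agreeW eb; lia.
      - by apply: Ee; split => //; apply: gN4.
    move=> M; have [_ [s' [[b1 b2 gs' b4 b5] [-> rs']]] eb] := hej M.
    exists s'; split => // l; rewrite leq_eqVlt => /orP[/eqP->|ln].
      by rewrite /alpha' !upd_eq; apply: agree_bpair.
    by rewrite /alpha' !upd_lt//; apply: b4.
  have [ej hej] := choice hex.
  have [|b Eb Hb] := E_regular Hx (u := bsnd (rep n x).2) (e := ej).
    by move=> j /hej[].
  exists (upd x n.+1 (ans b)); split => //; split; first by rewrite upd_lt.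
    apply: (Kplay_upd W) => //; apply: gans => //; by case: qx.
  by apply: H_up Hb => j /= [/hej[_ h] <-].
Qed.

(** Nothing is removed yet, so every sequence is generic; truncating [r] at [k] provides densely
    many points that branch in every direction. *)
Lemma stage0 : stage 0 zero_seq 0 (fun=> set0) (fun s _ => Phi s).
Proof.
split.
- by move=> k r m; exists r, m; split => [|s _ []].
- by move=> s _ _; split => //; split.
- by move=> s M _ _; exists M => s' _ _ ss' i _; apply: Phi_lip.
- move=> r k _.
  pose s : baire := fun i => if (i < k)%N then r i else 0%N.
  exists s, (fun=> Phi s); split; first by move=> i ik; rewrite /s ik.
  split; [by []|by split|].
  apply: H_up H_T => j _ M.
  pose s' : baire := fun l => if (l < maxn k M)%N then s l else j.+1.
  have ss' : agree (maxn k M) s s' by move=> l lm; rewrite /s' lm.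
  have ssM : agree M s s' by apply: agreeW ss'; apply: leq_maxr.
  exists s'; split.
  - exists (maxn k M); split => //; first by rewrite /s' ltnn.
    by move=> l; rewrite geq_max => /andP[kl _]; rewrite /s ltnNge kl.
  - exact: ssM.
  - by move=> k0 [].
  - by move=> i _; apply: Phi_lip.
Qed.

Record state := State {
  st_rho : baire; st_m : nat; st_N : nat -> set baire;
  st_alpha : baire -> nat -> baire }.

Theorem generic_game_false : False.
Proof.
pose inv n (t : state) := stage n (st_rho t) (st_m t) (st_N t) (st_alpha t).
have step (p : nat * state) : exists t' : state, inv p.1 p.2 ->
    [/\ inv p.1.+1 t',
        subcyl (st_rho t') (st_m t') (st_rho p.2) (st_m p.2),
        (p.1 < st_m t')%N,
        forall k s, (k < p.1)%N -> agree (st_m t') (st_rho t') s ->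
          ~ st_N p.2 k s &
        (forall k, st_N p.2 k `<=` st_N t' k) /\
        forall s i, (i <= p.1)%N -> st_alpha t' s i = st_alpha p.2 s i].
  case: p => n t; have [It|] := pselect (inv n t); last by exists t.
  have [r' [m' [N' [al' [st' c' NN' aa']]]]] := stageS It.
  (* The next cylinder also avoids the first [n] sets of the current family, so that the limit of
     the cylinders is generic for every stage. *)
  have [r2 [m2 [c2 h2]]] := nwd_avoid n r' (maxn m' n.+1) (stage_nwd It).
  have c2' : subcyl r2 m2 r' m'.
    by apply: subcyl_trans c2 _; split => //; apply: leq_maxl.
  exists (State r2 m2 N' al') => _ /=; split => //.
  - exact: (stage_restrict st' c2' (stage_nwd st') (fun k => @subset_refl _ (N' k))).
  - exact: subcyl_trans c'.
  - by case: c2; lia.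
have [nxt hnxt] := choice step.
pose t := fix t n := if n is l.+1 then nxt (l, t l)
  else State zero_seq 0 (fun=> set0) (fun s _ => Phi s).
have It n : inv n (t n).
  elim: n => [|n IH]; first exact: stage0.
  by have [] := hnxt (n, t n) IH.
have ht n := hnxt (n, t n) (It n).
have [|n|s hs] := @cyl_limit (fun n => st_rho (t n)) (fun n => st_m (t n)).
- by case=> // n; have [] := ht n.
- by have [] := ht n.
have NN n l k : (n <= l)%N -> st_N (t n) k `<=` st_N (t l) k.
  elim: l => [|l IH]; first by rewrite leqn0 => /eqP->.
  rewrite leq_eqVlt => /orP[/eqP->//|nl] s' /(IH nl).
  by have [_ _ _ _ [h _]] := ht l; apply: h.
have aa n l i : (i <= n)%N -> (n <= l)%N ->
    st_alpha (t l) s i = st_alpha (t n) s i.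
  move=> ni; elim: l => [|l IH]; first by rewrite leqn0 => /eqP->.
  rewrite leq_eqVlt => /orP[/eqP->//|nl].
  have [_ _ _ _ [_ h]] := ht l; rewrite -(IH nl); apply: h; exact: leq_trans ni nl.
have gs n : generic (st_N (t n)) s.
  move=> k Nk; have [_ _ _ h _] := ht (maxn n k.+1).
  apply: (h k s); [exact: leq_maxr|exact: hs (maxn n k.+1).+1|].
  by apply: (NN n) Nk; apply: leq_maxl.
apply: (no_infinite_play W gg (x := fun i => st_alpha (t i) s i)) => n.
have [_ pn] := stage_play (It n) (hs n) (gs n).
by apply: (Kplay_ext W _ pn) => i ni; rewrite (aa i n).
Qed.

End generic_game.

(** * Names of reals and binary expansions *)

Local Open Scope ring_scope.

Local Arguments cauchy_name {R} p x.
Local Arguments binary_expansion {R} u x.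

Section names.
Variable R : realType.
Implicit Types (x y z : R) (p u : baire).

Definition hpow (n : nat) : R := 2^-1 ^+ n.

Lemma hpow_gt0 n : 0 < hpow n.
Proof. by rewrite exprn_gt0// invr_gt0. Qed.

Lemma hpowS n : hpow n.+1 = hpow n / 2.
Proof. by rewrite /hpow exprSr. Qed.

Lemma hpowE n : hpow n = (2 ^+ n)^-1.
Proof. by rewrite /hpow exprVn. Qed.

Lemma hpow_le n m : (n <= m)%N -> hpow m <= hpow n.
Proof.
move=> nm; rewrite -(subnKC nm) /hpow exprD; apply: ler_piMr.
  exact: ltW (hpow_gt0 n).
by apply: exprn_ile1; lra.
Qed.

Lemma ratr_hpow n : ratr (2^-1 ^+ n) = hpow n.
Proof. by rewrite rmorphXn/= fmorphV/= rmorph_nat. Qed.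

Lemma hpow_lt (e : R) : 0 < e -> exists n, hpow n < e.
Proof.
move=> e0; have : geometric 1 2^-1 @ \oo --> (0 : R).
  by apply: cvg_geometric; rewrite ger0_norm; lra.
move=> /cvgrPdist_lt/(_ e e0)[n _ /(_ n (leqnn n))] /=.
rewrite sub0r normrN mul1r ger0_norm; last exact: ltW (hpow_gt0 n).
by move=> h; exists n.
Qed.

Lemma le_hpow_eq x y (C : R) : 0 <= C ->
  (forall n, `|x - y| <= C * hpow n) -> x = y.
Proof.
move=> C0 h; apply/eqP; rewrite -subr_eq0 -normr_le0 leNgt; apply/negP => d0.
have C1 : 0 < C + 1 by lra.
have [n hn] := hpow_lt (divr_gt0 d0 C1).
rewrite ltr_pdivlMr// in hn.
have := h n; have := hpow_gt0 n; nra.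
Qed.

(** The limit is the supremum of the lower bounds [q n - hpow n], each of which is at most every
    [q m + hpow m]. *)
Lemma regular_limit (q : nat -> R) :
  (forall n m, (n <= m)%N -> `|q n - q m| <= hpow n) ->
  exists x, forall n, `|q n - x| <= hpow n.
Proof.
move=> qr.
pose A : set R := [set q n - hpow n | n in setT].
have ub m : ubound A (q m + hpow m).
  move=> _ [n _ <-]; have := hpow_gt0 n; have := hpow_gt0 m.
  have [nm|mn] := leqP n m.
    by have := qr _ _ nm; rewrite ler_norml => /andP[]; lra.
  by have := qr _ _ (ltnW mn); rewrite ler_norml => /andP[]; lra.
have A0 : A !=set0 by exists (q 0%N - hpow 0); exists 0%N.
exists (sup A) => n; rewrite ler_norml; apply/andP; split.
  by have := ge_sup A0 (ub n); lra.
have : q n - hpow n <= sup A.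
  by apply: ub_le_sup; [exists (q 0%N + hpow 0%N)|exists n].
lra.
Qed.

Lemma cvg_hpow (q : nat -> R) x : (forall n, `|q n - x| <= hpow n) ->
  q @ \oo --> x.
Proof.
move=> h; apply/cvgrPdist_lt => e e0; have [n hn] := hpow_lt e0.
exists n => // m /= nm; rewrite distrC; apply: le_lt_trans (h m) _.
exact: le_lt_trans (hpow_le nm) hn.
Qed.

Lemma cvg_bound (q : nat -> R) x y (e : R) n : q @ \oo --> x ->
  (forall m, (n <= m)%N -> `|y - q m| <= e) -> `|y - x| <= e.
Proof.
move=> qx h; apply/ler_addgt0Pl => d d0.
move/cvgrPdist_lt : qx => /(_ d d0)[k _ hk].
have := hk (maxn n k) (leq_maxr _ _); have := h (maxn n k) (leq_maxl _ _).
rewrite /= => h1 h2.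
rewrite (_ : y - x = (y - q (maxn n k)) - (x - q (maxn n k))); last by ring.
by apply: le_trans (ler_normB _ _) _; lra.
Qed.

Lemma cauchy_nameP p x : cauchy_name p x -> exists q : nat -> rat,
  [/\ forall n, p n = pickle (q n), regular_Cauchy q
    & forall n, `|ratr (q n) - x| <= hpow n].
Proof.
move=> [q [pq qr qx]]; exists q; split => // n.
apply: (cvg_bound (n := n) qx) => m nm.
rewrite -rmorphB -ratr_norm -ratr_hpow ler_rat.
exact: ltW (qr _ _ nm).
Qed.

Lemma cauchy_nameI p x (q : nat -> rat) : (forall n, p n = pickle (q n)) ->
  regular_Cauchy q -> (forall n, `|ratr (q n) - x| <= hpow n) ->
  cauchy_name p x.
Proof. by move=> pq qr qx; exists q; split => //; apply: cvg_hpow. Qed.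

(** Entry [k] alone codes a rational within [hpow k] of the real. *)
Lemma cauchy_name_dist p p' x x' k : cauchy_name p x -> cauchy_name p' x' ->
  p k = p' k -> `|x - x'| <= 2 * hpow k.
Proof.
move=> /cauchy_nameP[q [pq _ qx]] /cauchy_nameP[q' [pq' _ qx']].
rewrite pq pq' => /(pcan_inj pickleK) qq.
have := qx k; have := qx' k; rewrite -qq => h1 h2.
rewrite (_ : x - x' = (ratr (q k) - x') - (ratr (q k) - x)); last by ring.
by apply: le_trans (ler_normB _ _) _; lra.
Qed.

Lemma cauchy_name_uniq p x x' : cauchy_name p x -> cauchy_name p x' -> x = x'.
Proof.
move=> px px'; apply: (@le_hpow_eq _ _ 2) => // n.
exact: cauchy_name_dist px px' _.
Qed.

(** * Binary expansions and their partial sums *)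

Definition bsum (u : baire) (n : nat) : R :=
  \sum_(0 <= k < n) (u k)%:R * hpow k.+1.

Lemma bsumS u n : bsum u n.+1 = bsum u n + (u n)%:R * hpow n / 2.
Proof. by rewrite /bsum big_nat_recr//= hpowS mulrA. Qed.

Lemma bsum0 u : bsum u 0 = 0.
Proof. by rewrite /bsum big_geq. Qed.

Lemma bsum_agree u v n : agree n u v -> bsum u n = bsum v n.
Proof.
move=> uv; apply: eq_big_nat => k /andP[_ kn]; by rewrite uv.
Qed.

Lemma bsum_mono u n m : (forall k, (u k < 2)%N) -> (n <= m)%N ->
  bsum u n <= bsum u m <= bsum u n + hpow n - hpow m.
Proof.
move=> u2; elim: m => [|m IH]; first by rewrite leqn0 => /eqP->; lra.
rewrite leq_eqVlt => /orP[/eqP->|nm]; first by lra.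
have /andP[h1 h2] := IH nm; rewrite bsumS hpowS.
have := hpow_gt0 m; have := u2 m; case: (u m) => [|[|//]] _ h3 /=; lra.
Qed.

Lemma binary_expansionP u x : binary_expansion u x <->
  (forall n, (u n < 2)%N) /\
  (forall n, bsum u n <= x <= bsum u n + hpow n).
Proof.
have sE : series (fun n => (u n)%:R * 2^-1 ^+ n.+1 : R) = bsum u by [].
split=> [[u2]|[u2 h]]; last first.
  split => //; rewrite sE; apply: cvg_hpow => n.
  have := h n => /andP[h1 h2]; rewrite ler_norml; apply/andP; split; lra.
rewrite sE => ux; split => // n.
(* Later partial sums lie in an interval of length [hpow n]; centred at its midpoint, this is a
   distance bound that passes to the limit. *)
have hu k : (n <= k)%N -> `|bsum u n + hpow n / 2 - bsum u k| <= hpow n / 2.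
  move=> nk; have /andP[h1 h2] := bsum_mono u2 nk; have := hpow_gt0 k => h3.
  rewrite ler_norml; apply/andP; split; lra.
have := cvg_bound ux hu; rewrite ler_norml => /andP[h1 h2].
by apply/andP; split; lra.
Qed.

Lemma BE_compact : compact_pb (BE_pb R).
Proof.
split; first exists (fun=> 1%N).
  by move=> u b [x [_ _ [b2 _]]] k; have := b2 k; lia.
move=> u b [w [x [x01 ux _]]] h; exists x; split => //.
apply/binary_expansionP; split.
  move=> n; have [u' [b' [_ bb' [x' [_ _ [b2 _]]]]]] := h n.+1.
  by rewrite bb'//; apply: b2.
move=> n.
have key k : (n <= k)%N -> bsum b n - 2 * hpow k <= x <= bsum b n + hpow n + 2 * hpow k.
  move=> nk; have [u' [b' [uu' bb' [x' [_ ux' /binary_expansionP[b2 hb]]]]]] := h k.+1.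
  have := cauchy_name_dist ux ux' (uu' k (ltnSn k)).
  rewrite ler_norml => /andP[d1 d2].
  have := hb n; rewrite -(@bsum_agree b b'); last first.
    by apply: agreeW bb'; lia.
  by move=> /andP[h1 h2]; apply/andP; split; lra.
apply/andP; split; rewrite leNgt; apply/negP => hlt.
  have [|k hk] := @hpow_lt ((bsum b n - x) / 2); first lra.
  have := key (maxn n k) (leq_maxl _ _); have := hpow_le (leq_maxr n k); lra.
have [|k hk] := @hpow_lt ((x - (bsum b n + hpow n)) / 2); first lra.
have := key (maxn n k) (leq_maxl _ _); have := hpow_le (leq_maxr n k); lra.
Qed.

(** At the first difference both expansions force [x] to be the midpoint of a dyadic interval, which
    fixes both tails. *)
Lemma binary_expansion_lt b b' x k : binary_expansion b x ->
  binary_expansion b' x -> agree k b b' -> b k = 0%N -> b' k = 1%N ->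
  (forall l, (k < l)%N -> b l = 1%N) /\ (forall l, (k < l)%N -> b' l = 0%N).
Proof.
move=> /binary_expansionP[b2 hb] /binary_expansionP[b2' hb'] bb' bk bk'.
have e0 := bsum_agree bb'.
have := hb k.+1; have := hb' k.+1; rewrite !bsumS bk bk' hpowS e0 => h1 h2.
have xE : x = bsum b' k + hpow k / 2 by lra.
split => l kl.
  have := hb l.+1; have /andP[_] := bsum_mono b2 kl.
  rewrite !bsumS !hpowS bk e0 xE; have := hpow_gt0 l.
  have := b2 l; case: (b l) => [|[|//]] _ //= h3 h4 h5; clear bk bk'; exfalso; lra.
have := hb' l.+1; have /andP[+ _] := bsum_mono b2' kl.
rewrite !bsumS !hpowS bk' xE; have := hpow_gt0 l.
have := b2' l; case: (b' l) => [|[|//]] _ //= h3 h4 h5; clear bk bk'; exfalso; lra.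
Qed.

Lemma binary_expansion_opp b b' x : binary_expansion b x ->
  binary_expansion b' x -> b <> b' -> exists k, forall l, (k < l)%N ->
  b l = (1 - b' l)%N.
Proof.
move=> hb hb' bb'.
have [|k /eqP kb kmin] := @least_nat [set k | b k != b' k].
  apply: contrapT => h; apply: bb'; apply/funext => k.
  by apply/eqP; apply: contrapT => /negP bk; apply: h; exists k.
have ag : agree k b b'.
  move=> l lk; apply/eqP; apply: contrapT => /negP/kmin; lia.
have := hb.1 k; have := hb'.1 k; case Eb : (b k) => [|[|//]] //;
  case Eb' : (b' k) => [|[|//]] // _ _; try by rewrite Eb Eb' in kb.
- have [h1 h2] := binary_expansion_lt hb hb' ag Eb Eb'.
  by exists k => l kl; rewrite h1// h2.
- have [h1 h2] := binary_expansion_lt hb' hb (agree_sym ag) Eb' Eb.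
  by exists k => l kl; rewrite h1// h2.
Qed.

(** Three distinct expansions would be eventually complementary in pairs, impossible with digits 0
    and 1. *)
Lemma binary_expansion_two b1 b2 b3 x : binary_expansion b1 x ->
  binary_expansion b2 x -> binary_expansion b3 x ->
  b1 <> b2 -> b3 = b1 \/ b3 = b2.
Proof.
move=> h1 h2 h3 n12; apply: contrapT => /not_orP[n31 n32].
have [k1 e1] := binary_expansion_opp h1 h2 n12.
have [k2 e2] := binary_expansion_opp h3 h1 n31.
have [k3 e3] := binary_expansion_opp h3 h2 n32.
pose l := (maxn k1 (maxn k2 k3)).+1.
have := e1 l; have := e2 l; have := e3 l; have := h1.1 l; have := h2.1 l.
rewrite /l; lia.
Qed.

Lemma BE_regular : partition_regular (BE_pb R) unbounded.
Proof.
move=> u A e Ainf hA.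
have [j0 _ Aj0] := Ainf 0%N.
have [x [x01 ux b0]] := hA _ Aj0.
have hx j : A j -> binary_expansion (e j) x.
  by move=> /hA[x' [_ ux' bj]]; rewrite (cauchy_name_uniq ux ux').
have [[j1 [Aj1 n1]]|all] := pselect (exists j, A j /\ e j0 <> e j).
  have : unbounded ([set j | A j /\ e j = e j0] `|` [set j | A j /\ e j = e j1]).
    move=> m; have [n mn An] := Ainf m; exists n => //.
    by have [|] := binary_expansion_two (hx _ Aj0) (hx _ Aj1) (hx _ An) n1;
      [left|right].
  by case/unbounded_setU => h; [exists (e j0)|exists (e j1)] => //; apply: hA.
exists (e j0); first exact: hA.
move=> m; have [n mn An] := Ainf m; exists n => //; split => //.
by apply: contrapT => h; apply: all; exists n; split => // hh; apply: h.
Qed.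

Lemma binary_expansion_exists x : 0 <= x < 1 -> exists u, binary_expansion u x.
Proof.
move=> /andP[x0 x1].
(* The digits are read off these truncations; [x < 1] makes the first of them 0. *)
pose fl n : nat := Num.truncn (x * 2 ^+ n).
have flP n : (fl n)%:R * hpow n <= x < ((fl n)%:R + 1) * hpow n.
  have h0 : 0 <= x * 2 ^+ n by rewrite mulr_ge0// exprn_ge0.
  have /andP[h1 h2] := truncn_itv h0.
  rewrite hpowE ler_pdivrMr ?exprn_gt0// h1/= ltr_pdivlMr ?exprn_gt0//.
  by rewrite natr1.
have fl2 n : (fl n.+1 = (fl n).*2 \/ fl n.+1 = (fl n).*2.+1)%N.
  have /andP[h1 h2] := flP n; have /andP[h3 h4] := flP n.+1.
  rewrite hpowS in h3 h4; have h5 := hpow_gt0 n.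
  have l1 : ((fl n).*2 < (fl n.+1).+1)%N.
    rewrite -(ltr_nat R) -addnn natrD -natr1.
    rewrite -(ltr_pM2r h5); lra.
  have l2 : (fl n.+1 < (fl n).*2.+2)%N.
    rewrite -(ltr_nat R) -2!natr1 -addnn natrD.
    rewrite -(ltr_pM2r h5); lra.
  lia.
pose u : baire := fun n => (fl n.+1 - (fl n).*2)%N.
exists u; apply/binary_expansionP; split.
  by move=> n; rewrite /u; case: (fl2 n) => ->; lia.
have bE n : bsum u n = (fl n)%:R * hpow n.
  elim: n => [|n IH].
    rewrite bsum0 (_ : fl 0%N = 0%N) ?mul0r//; apply/eqP.
    by rewrite -leqn0 leqNgt; apply/negP => h; have := flP 0%N;
      rewrite /hpow expr0 !mulr1 => /andP[+ _]; have : (1 : R) <= (fl 0%N)%:R;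
      [rewrite ler1n|lra].
  rewrite bsumS IH /u hpowS; case: (fl2 n) => ->.
    by rewrite subnn -muln2 natrM; lra.
  by rewrite subSnn -muln2 -[in RHS]natr1 natrM; lra.
move=> n; have /andP[h1 h2] := flP n; rewrite bE h1/=.
by apply: ltW; rewrite mulrDl mul1r in h2.
Qed.

End names.

(** * Division *)

(** Fills a missing factor, so that a single problem can be treated as a product. *)
Definition trivial_pb : multifun := fun=> [set zero_seq].

Lemma trivial_compact : compact_pb trivial_pb.
Proof.
split; first by exists (fun=> 0%N) => u b ->.
move=> u b _ h; apply/funext => k.
by have [u' [b' [_ bb' eb]]] := h k.+1; rewrite bb'// eb.
Qed.

Lemma trivial_regular H : up_closed H -> partition_regular trivial_pb H.
Proof.
move=> Hup u A e HA hA; exists zero_seq => //.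
by apply: Hup HA => j Aj; split => //; apply: hA.
Qed.

Lemma trivial_tame : tame trivial_pb trivial_pb trivial_pb setT zero_seq (fun=> 0%N).
Proof.
have [_ cl] := trivial_compact.
split.
- by [].
- by move=> u b ->.
- exact: cl.
- by move=> u _ _; exists 0%N.
- by [].
- by move=> u _ _; exists zero_seq.
- by move=> u b _ _ -> M; exists 0%N => u' _ _ _; exists zero_seq.
- by move=> u _ [].
Qed.

Section division.
Variable R : realType.
Implicit Types (x y z : R) (p u : baire).
Local Notation hpow := (hpow R).

Lemma le_hpow (a b C : R) : 0 <= C -> (forall n, a <= b + C * hpow n) -> a <= b.
Proof.
move=> C0 h; rewrite leNgt; apply/negP => ba.
have C1 : 0 < C + 1 by lra.
have ab0 : 0 < a - b by lra.
have [n hn] := hpow_lt (divr_gt0 ab0 C1).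
rewrite ltr_pdivlMr// in hn.
have := h n; have := hpow_gt0 R n; nra.
Qed.

Definition dyadic (k n : nat) : rat := k%:R * 2^-1 ^+ n.

Lemma ratr_dyadic k n : ratr (dyadic k n) = k%:R * hpow n :> R.
Proof. by rewrite rmorphM/= rmorph_nat ratr_hpow. Qed.

(** Each entry ranges over a finite grid, which bounds the names of reals in the unit interval. The
    spacing [hpow n.+2] leaves slack for regularity. *)
Definition grid_name (u : baire) z := forall n, exists k,
  [/\ (k <= 2 ^ n.+2)%N, u n = pickle (dyadic k n.+2)
    & `|k%:R * hpow n.+2 - z| <= hpow n.+2].

(** Strict inequality is an open condition on [z], as needed to follow quotients continuously; the
    weak one is closed, as needed for limits. *)
Definition strict_grid_name (u : baire) z := forall n, exists k,
  [/\ (k <= 2 ^ n.+2)%N, u n = pickle (dyadic k n.+2)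
    & `|k%:R * hpow n.+2 - z| < hpow n.+2].

Lemma strict_grid_nameW u z : strict_grid_name u z -> grid_name u z.
Proof. by move=> h n; have [k [h1 h2 /ltW h3]] := h n; exists k. Qed.

Lemma grid_name_cauchy u z : grid_name u z -> cauchy_name u z.
Proof.
move=> /choice[k hk]; apply: (@cauchy_nameI _ _ _ (fun n => dyadic (k n) n.+2)).
- by move=> n; have [] := hk n.
- move=> n m nm; rewrite -(ltr_rat R) ratr_norm rmorphB/= !ratr_dyadic ratr_hpow.
  have [_ _ h1] := hk n; have [_ _ h2] := hk m.
  rewrite (_ : _ - _ = ((k n)%:R * hpow n.+2 - z) - ((k m)%:R * hpow m.+2 - z));
    last by ring.
  apply: le_lt_trans (ler_normB _ _) _.
  have := hpow_le R nm; have := hpow_gt0 R n.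
  rewrite !hpowS in h1 h2 *; lra.
- move=> n; have [_ _ h1] := hk n; rewrite ratr_dyadic.
  apply: le_trans h1 _; apply: hpow_le; lia.
Qed.

Lemma strict_grid_name_exists z : 0 <= z <= 1 -> exists u, strict_grid_name u z.
Proof.
move=> /andP[z0 z1].
pose k n : nat := Num.truncn (z * 2 ^+ n.+2).
exists (fun n => pickle (dyadic (k n) n.+2)) => n; exists (k n).
have p0 : 0 < (2 : R) ^+ n.+2 by rewrite exprn_gt0.
have h0 : 0 <= z * 2 ^+ n.+2 by rewrite mulr_ge0// ltW.
have /andP[h1 h2] := truncn_itv h0; split => //.
  rewrite -(ler_nat R) natrX; apply: le_trans h1 _.
  by rewrite -[leRHS]mul1r; apply: ler_wpM2r; rewrite // ltW.
rewrite /k; move: h1 h2; set t := Num.truncn _; rewrite -natr1 => h1 h2.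
have hz : z = (z * 2 ^+ n.+2) * hpow n.+2.
  by rewrite hpowE mulfK// gt_eqF.
rewrite [in ltLHS]hz -mulrBl normrM (gtr0_norm (hpow_gt0 R _)).
rewrite -[ltRHS]mul1r (ltr_pM2r (hpow_gt0 R _)) ltr_norml; apply/andP; split; lra.
Qed.

Definition division (gname : baire -> R -> Prop) (u b : baire) :=
  exists x y z : R,
    [/\ [/\ 0 <= x <= 1, 0 <= y <= 1 & x <= y],
        cauchy_name (bfst u) x /\ cauchy_name (bsnd u) y,
        0 <= z <= 1 /\ x = y * z
      & gname b z].

Definition divisor_pos u := exists2 y : R, cauchy_name (bsnd u) y & 0 < y.

Definition grid_bound n : nat :=
  \max_(k < (2 ^ n.+2).+1) pickle (dyadic k n.+2).

(** The grid points coded by [b] converge to some [z], which is also the limit of the quotients of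
    the approximating pairs; then [x' = y' * z'] passes to the limit. *)
Lemma division_closed :
  closed_rel (dom (RDIV_pb R)) (division grid_name).
Proof.
move=> u b [w [x [y [z1 [[x01 y01 xy] [ux uy] _ _]]]]] h.
have {}h M : exists x' y' z', [/\ 0 <= y' <= 1, 0 <= z' <= 1, x' = y' * z',
    `|x - x'| <= 2 * hpow M /\ `|y - y'| <= 2 * hpow M &
    exists2 b', grid_name b' z' & agree M.+1 b b'].
  have [u' [b' [uu' bb' [x' [y' [z' [[x01' y01' xy'] [ux' uy'] [z01' xyz'] gz']]]]]]]
    := h M.+1.*2.
  exists x', y', z'; split => //.
    split.
      exact: cauchy_name_dist ux ux' (agree_bfst uu' (ltnSn M)).
    exact: cauchy_name_dist uy uy' (agree_bsnd uu' (ltnSn M)).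
  by exists b' => //; apply: agreeW bb'; rewrite -addnn leq_addr.
have hk n : exists k, (k <= 2 ^ n.+2)%N /\ b n = pickle (dyadic k n.+2).
  have [x' [y' [z' [_ _ _ _ [b' gb' bb']]]]] := h n.
  by have [k [k1 k2 _]] := gb' n; exists k; rewrite bb'.
have {hk}[k hk] := choice hk.
pose q n := (k n)%:R * hpow n.+2.
have qz b' z' n M : grid_name b' z' -> agree M.+1 b b' -> (n <= M)%N ->
    `|q n - z'| <= hpow n.+2.
  move=> gb' bb' nM; have [l [_ l2 l3]] := gb' n.
  move: l2; rewrite -bb'// (hk n).2 => /(pcan_inj pickleK) e.
  by move: l3; rewrite /q -!ratr_dyadic e.
have qq n m : (n <= m)%N -> `|q n - q m| <= hpow n.+2 + hpow m.+2.
  move=> nm; have [x' [y' [z' [_ _ _ _ [b' gb' bb']]]]] := h m.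
  rewrite (_ : q n - q m = (q n - z') - (q m - z')); last by ring.
  apply: le_trans (ler_normB _ _) _.
  by apply: lerD; apply: qz gb' bb' _.
have [|z hz] := @regular_limit R q.
  move=> n m nm; apply: le_trans (qq _ _ nm) _.
  have := hpow_le R nm; have := hpow_gt0 R n; rewrite !hpowS; lra.
have hz2 n : `|q n - z| <= hpow n.+2.
  apply: (@le_hpow _ _ 2) => // m.
  have nM := leq_maxl n m; have mM := hpow_le R (leq_maxr n m).
  have h1 := qq _ _ nM; have h2 := hz (maxn n m).
  rewrite (_ : q n - z = (q n - q (maxn n m)) + (q (maxn n m) - z)); last by ring.
  apply: le_trans (ler_normD _ _) _.
  have := hpow_gt0 R m; move: h1; rewrite !hpowS; lra.
have zz M : exists x' y' z', [/\ 0 <= y' <= 1, 0 <= z' <= 1, x' = y' * z',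
    `|x - x'| <= 2 * hpow M /\ `|y - y'| <= 2 * hpow M & `|z - z'| <= hpow M].
  have [x' [y' [z' [h1 h2 h3 h4 [b' gb' bb']]]]] := h M.
  exists x', y', z'; split => //.
  have l1 := qz _ _ _ _ gb' bb' (leqnn M); have l2 := hz2 M.
  rewrite (_ : z - z' = (q M - z') - (q M - z)); last by ring.
  apply: le_trans (ler_normB _ _) _; move: l1 l2; rewrite !hpowS.
  have := hpow_gt0 R M; lra.
have z01 : 0 <= z <= 1.
  apply/andP; split; apply: (@le_hpow _ _ 1) => // M.
    have [x' [y' [z' [_ /andP[h1 h2] _ _]]]] := zz M.
    rewrite ler_norml; lra.
  have [x' [y' [z' [_ /andP[h1 h2] _ _]]]] := zz M.
  rewrite ler_norml; lra.
exists x, y, z; split => //; last first.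
  by move=> n; exists (k n); split; [exact: (hk n).1|exact: (hk n).2|exact: hz2].
split => //; apply: (@le_hpow_eq _ _ _ 5) => // M.
have [x' [y' [z' [/andP[a1 a2] _ xE [d1 d2] d3]]]] := zz M.
rewrite (_ : x - y * z = (x - x') + (y' * (z' - z) + (y' - y) * z)); last first.
  by rewrite xE; ring.
have /andP[zz0 zz1] := z01.
have e1 : `|y' * (z' - z)| <= hpow M.
  by rewrite normrM (ger0_norm a1) distrC -[leRHS]mul1r ler_pM.
have e2 : `|(y' - y) * z| <= 2 * hpow M.
  by rewrite normrM (ger0_norm zz0) distrC -[leRHS]mulr1 ler_pM.
apply: le_trans (ler_normD _ _) _.
have := ler_normD (y' * (z' - z)) ((y' - y) * z); lra.
Qed.

Lemma RDIV_tame : tame (RDIV_pb R) (division grid_name)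
  (fun u b => division strict_grid_name u b) divisor_pos
  (fun=> pickle (dyadic 0 0)) grid_bound.
Proof.
split.
- move=> u b [x [y [z [h1 h2 h3 h4]]]]; exists x, y, z; split => //.
  exact: grid_name_cauchy.
- move=> u b [x [y [z [_ _ _ gz]]]] n; have [k [k1 -> _]] := gz n.
  have k1' : (k < (2 ^ n.+2).+1)%N by [].
  exact: (leq_bigmax (F := fun k : 'I_(2 ^ n.+2).+1 => pickle (dyadic k n.+2))
    (Ordinal k1')).
- exact: division_closed.
- move=> u _ [y uy y0]; have [|k hk] := @hpow_lt R (y / 2); first lra.
  exists k.+1.*2 => u' [w [x' [y' [z' [_ [_ uy'] _ _]]]]] uu'.
  exists y' => //.
  have : `|y - y'| <= 2 * hpow k.
    exact: cauchy_name_dist uy uy' (agree_bsnd uu' (ltnSn k)).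
  rewrite ler_norml; lra.
- move=> u b [x [y [z [h1 h2 h3 h4]]]]; exists x, y, z; split => //.
  exact: strict_grid_nameW.
- move=> u [w [x [y [z [h1 h2 [z01 xyz] h4]]]]] _.
  by have [b hb] := strict_grid_name_exists z01; exists b, x, y, z.
- move=> u b _ [y uy y0] [x [y1 [z [[x01 y01 xy] [ux uy1] [z01 xyz] gz]]]] M.
  rewrite -(cauchy_name_uniq uy uy1) in y01 xy xyz => {y1 uy1}.
  (* Strictness leaves a margin [d] within which the first [M] entries of [b] stay correct for other
     quotients. *)
  have [d d0 hd] : exists2 d, 0 < d & forall n z', (n < M)%N -> `|z - z'| < d ->
      exists k, [/\ (k <= 2 ^ n.+2)%N, b n = pickle (dyadic k n.+2)
                  & `|k%:R * hpow n.+2 - z'| < hpow n.+2].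
    elim: M => [|M [d d0 hd]]; first by exists 1.
    have [k [k1 k2 k3]] := gz M.
    pose d1 := hpow M.+2 - `|k%:R * hpow M.+2 - z|.
    exists (Num.min d d1); first by rewrite lt_min d0/= subr_gt0.
    move=> n z' nM; rewrite lt_min => /andP[l1 l2].
    move: nM; rewrite ltnS leq_eqVlt => /orP[/eqP->|nM]; last exact: hd.
    exists k; split => //.
    rewrite (_ : _ - z' = (k%:R * hpow M.+2 - z) + (z - z')); last by ring.
    apply: le_lt_trans (ler_normD _ _) _; move: l2; rewrite /d1; lra.
  (* Dividends and divisors will each differ by at most [2 * hpow k0], and together these
     differences bound [y * (z - z')]. *)
  have [|k0 hk0] := @hpow_lt R (d * y / 4); first by rewrite divr_gt0// mulr_gt0.
  exists k0.+1.*2 => u' [w [x' [y' [z' [h1 [ux' uy'] [z01' xyz'] _]]]]] _ uu'.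
  have dx : `|x - x'| <= 2 * hpow k0.
    exact: cauchy_name_dist ux ux' (agree_bfst uu' (ltnSn k0)).
  have dy : `|y - y'| <= 2 * hpow k0.
    exact: cauchy_name_dist uy uy' (agree_bsnd uu' (ltnSn k0)).
  have dz : `|z - z'| < d.
    rewrite -(ltr_pM2l y0) -{1}(gtr0_norm y0) -normrM.
    rewrite (_ : y * (z - z') = (x - x') - (y - y') * z'); last first.
      by rewrite xyz xyz'; ring.
    apply: le_lt_trans (ler_normB _ _) _.
    have /andP[z0 z1] := z01'.
    have : `|(y - y') * z'| <= 2 * hpow k0.
      by rewrite normrM (ger0_norm z0) -[leRHS]mulr1 ler_pM.
    lra.
  have [b1 hb1] := strict_grid_name_exists z01'.
  (* The first [M] entries are kept; a fresh name of [z'] supplies the others. *)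
  exists (fun n => if (n < M)%N then b n else b1 n); last by move=> n ->.
  exists x', y', z'; split => // n; case: ltnP => nM; last exact: hb1.
  exact: hd.
- move=> u [w [x [y [z [[x01 y01 xy] [ux uy] _ _]]]]] nO.
  have y0 : y = 0.
    apply/eqP; rewrite eq_le; apply/andP; split; last by lra.
    by rewrite leNgt; apply/negP => y0; apply: nO; exists y.
  have x0 : x = 0 by lra.
  exists x, y, 0; split => //; first by split; [lra|rewrite y0 x0 mul0r].
  move=> n; exists 0%N; split => //; first by rewrite /dyadic !mul0r.
  by rewrite mul0r subrr normr0 ltW// hpow_gt0.
Qed.

End division.

(** * Hard instances of BE and RDIV *)

Lemma unbounded_two (A : set nat) : unbounded A ->
  exists j1 j2, [/\ A j1, A j2 & (j1 < j2)%N].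
Proof.
by move=> Ainf; have [j1 _ A1] := Ainf 0%N; have [j2 j12 A2] := Ainf j1.+1;
  exists j1, j2.
Qed.

Lemma unbounded_up : up_closed unbounded.
Proof. by move=> A B AB Ai m; have [n mn /AB] := Ai m; exists n. Qed.

Lemma unboundedT : unbounded setT.
Proof. by move=> m; exists m. Qed.

(** Largeness means that a move to the right (even [j]) and a move to the left (odd [j]) are both on
    offer. *)
Definition both_parities : set (set nat) := [set A |
  (exists2 j, A j & ~~ odd j) /\ (exists2 j, A j & odd j)].

Lemma both_parities_up : up_closed both_parities.
Proof.
by move=> A B AB [[j /AB Bj jo] [k /AB Bk ko]]; split; [exists j|exists k].
Qed.

Lemma both_paritiesT : both_parities setT.
Proof. by split; [exists 0%N|exists 1%N]. Qed.

(** * Dyadic walks: hard instances of [BE_pb] *)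

Definition shift_sign (d : nat) : rat :=
  if d is d'.+1 then (-1) ^+ d' else 0.

Fixpoint walk (s : baire) (n : nat) : rat :=
  if n is m.+1 then walk s m + shift_sign (s m) * 2^-1 ^+ m.+1.*2 else 2^-1.

(* Each nonzero entry of s moves the real away from the current dyadic
   rational, to the right or to the left according to its parity, by more than
   all the later moves together. *)
Definition walk_name (s : baire) : baire := fun n => pickle (walk s n).

Lemma walk_agree s s' n : agree n s s' -> walk s n = walk s' n.
Proof.
elim: n => [//|n IH] ss' /=; rewrite IH; last exact: agreeW ss'.
by rewrite ss'.
Qed.

Lemma walk_name_mono : prefix_monotone walk_name.
Proof.
move=> M s s' ss' n nM; rewrite /walk_name (@walk_agree s s')//.
by apply: agreeW ss'; apply: ltnW.
Qed.

Section walks.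
Variable R : realType.
Local Notation hpow := (hpow R).

Let W s n : R := ratr (walk s n).

Let WS s n : W s n.+1 = W s n + ratr (shift_sign (s n)) * hpow n.*2 / 4.
Proof.
rewrite /W /= rmorphD rmorphM/= ratr_hpow doubleS !hpowS; lra.
Qed.

Let sign_le d : -1 <= (ratr (shift_sign d) : R) <= 1.
Proof.
case: d => [|d] /=; first by rewrite rmorph0; lra.
by rewrite rmorph_sign -signr_odd; case: (odd d); rewrite ?expr0 ?expr1; lra.
Qed.

(** Step number [k] has size at most 4^-(k+1); the bound is the sum of a geometric series. *)
Lemma walk_dist s n m : (n <= m)%N ->
  `|W s n - W s m| <= (hpow n.*2 - hpow m.*2) / 3.
Proof.
elim: m => [|m IH]; first by rewrite leqn0 => /eqP->; rewrite !subrr normr0 mul0r.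
rewrite leq_eqVlt => /orP[/eqP->|nm]; first by rewrite !subrr normr0 mul0r.
have := IH nm; rewrite WS doubleS !hpowS.
have /andP[h1 h2] := sign_le (s m); have h3 := hpow_gt0 R m.*2.
rewrite !ler_norml => /andP[h4 h5]; apply/andP; split; nra.
Qed.

Lemma walk_limit s : exists2 x : R, cauchy_name (walk_name s) x &
  forall n, `|W s n - x| <= hpow n.*2 / 3.
Proof.
have h2 n : hpow n.*2 <= hpow n by apply: hpow_le; lia.
have Wr n m : (n <= m)%N -> `|W s n - W s m| <= hpow n / 3.
  move=> nm; apply: le_trans (walk_dist s nm) _.
  have := h2 n; have := hpow_gt0 R m.*2; lra.
have [|x hx] := @regular_limit R (W s).
  by move=> n m /Wr; have := hpow_gt0 R n; lra.
exists x.
  apply: (@cauchy_nameI _ _ _ (walk s)) => //.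
  move=> n m /Wr; rewrite -(ltr_rat R) ratr_norm rmorphB/= ratr_hpow.
  by have := hpow_gt0 R n; lra.
move=> n; apply: (cvg_bound (n := n) (cvg_hpow hx)) => m /(walk_dist s).
by have := hpow_gt0 R m.*2; lra.
Qed.

Lemma walk_const s m n : (forall k, (m <= k)%N -> s k = 0%N) -> (m <= n)%N ->
  walk s n = walk s m.
Proof.
move=> s0; elim: n => [|n IH]; first by rewrite leqn0 => /eqP->.
rewrite leq_eqVlt => /orP[/eqP->//|mn] /=.
by rewrite s0// mul0r addr0 IH.
Qed.

Lemma walk_dyadic s n : exists c : int, W s n = c%:~R * hpow n.*2.+1.
Proof.
elim: n => [|n [c hc]].
  exists 1; rewrite /W /= hpowS /hpow expr0 mul1r.
  by rewrite fmorphV/= rmorph_nat mul1r.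
have [d hd] : exists d : int, (ratr (shift_sign (s n)) : R) = d%:~R.
  case: (s n) => [|k] /=; first by exists 0; rewrite rmorph0.
  by exists ((-1) ^+ k); rewrite !rmorph_sign.
exists (4 * c + 2 * d); rewrite WS hc hd doubleS !hpowS.
by rewrite rmorphD !rmorphM/=; lra.
Qed.

Lemma walk_name_BE_dom s : dom (BE_pb R) (walk_name s).
Proof.
have [x sx hx] := walk_limit s.
have := hx 0%N; rewrite /W /= /hpow expr0 fmorphV/= rmorph_nat ler_norml => h0.
have [|u hu] := @binary_expansion_exists R x; first lra.
by exists u, x; split => //; lra.
Qed.

Lemma walk_evt0 s m (x : R) : (forall k, (m <= k)%N -> s k = 0%N) ->
  cauchy_name (walk_name s) x -> x = W s m.
Proof.
move=> s0 sx; have [y sy hy] := walk_limit s.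
rewrite (cauchy_name_uniq sx sy); apply/esym.
apply: (@le_hpow_eq _ _ _ 1) => // n; rewrite mul1r.
have nm := leq_maxr n m; rewrite /W -(walk_const s0 nm).
apply: le_trans (hy _) _.
have : hpow (maxn n m).*2 <= hpow n by apply: hpow_le; lia.
have := hpow_gt0 R (maxn n m).*2; lra.
Qed.

Lemma walk_name_BEQ_dom s : evt0 s -> dom (BEQ_pb R) (walk_name s).
Proof.
move=> [m s0]; have [u hu] := walk_name_BE_dom s; exists u; split => //.
have [x sx _] := walk_limit s.
by exists (walk s m); rewrite (_ : ratr _ = x)//; apply/esym/(walk_evt0 s0 sx).
Qed.

Lemma bsum_dyadic (u : baire) n : exists c : nat, bsum R u n = c%:R * hpow n.
Proof.
elim: n => [|n [c hc]]; first by exists 0%N; rewrite bsum0 mul0r.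
exists (2 * c + u n)%N; rewrite bsumS hc hpowS natrD natrM; lra.
Qed.

(** The step at [m] has size [hpow m.*2 / 4], while all later ones add up to at most
    [hpow m.*2 / 12]. *)
Lemma walk_branch s s' j m (x' : R) : agree m s s' -> s' m = j.+1 ->
  cauchy_name (walk_name s') x' ->
  if odd j then x' < W s m else W s m < x'.
Proof.
move=> ss' sm sx'; have [y sy hy] := walk_limit s'.
rewrite (cauchy_name_uniq sx' sy); have := hy m.+1.
rewrite WS -[W s' m]/(ratr (walk s' m)) -(walk_agree ss') -/(W s m) sm /=.
rewrite rmorph_sign -signr_odd doubleS !hpowS ler_norml.
have h := hpow_gt0 R m.*2.
by case: (odd j); rewrite ?expr0 ?expr1 => /andP[h1 h2]; lra.
Qed.

(** Here [x] is a multiple of [hpow m.*2.+1], so the first [m.*2.+1] digits of [u] place it at an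
    end of a dyadic interval; a branch leading out of that interval cannot share these digits. *)
Lemma walk_name_BE_hard s : hard_at (BE_pb R) walk_name both_parities s.
Proof.
move=> u A [[je Aje je0] [jo Ajo jo1]] [x [x01 sx /binary_expansionP[u2 hu]]].
(* A sequence that is not eventually zero has no branches, so hardness is vacuous there. *)
have [[m s0]|ns] := pselect (evt0 s); last first.
  exists je => //; exists 0%N => s' u' [m [_ _ s0]].
  by case: ns; exists m.
have [c hc] := walk_dyadic s m; have [d hd] := bsum_dyadic u m.*2.+1.
have xE := walk_evt0 s0 sx.
have h0 := hpow_gt0 R m.*2.+1.
have side : x = bsum R u m.*2.+1 \/ x = bsum R u m.*2.+1 + hpow m.*2.+1.
  have /andP[] := hu m.*2.+1; rewrite xE hc hd -[X in _ + X]mul1r -mulrDl.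
  rewrite (ler_pM2r h0) (ler_pM2r h0).
  rewrite -[d%:R]/(d%:Z%:~R) -[1]/(1%:~R) -intrD !ler_int => l1 l2.
  have [->|->] : c = d%:Z \/ c = d%:Z + 1 by lia.
    by left.
  by right; rewrite intrD mulrDl.
have key s' u' j : branch s j s' -> BE_pb R (walk_name s') u' ->
    agree m.*2.+1 u u' -> exists x' : R,
    (if odd j then x' < x else x < x') /\
    bsum R u m.*2.+1 <= x' <= bsum R u m.*2.+1 + hpow m.*2.+1.
  move=> [m' [ss' sm' s0']] [x' [_ sx' /binary_expansionP[_ hu']]] uu'.
  exists x'; rewrite (bsum_agree R uu'); split => //.
  by rewrite (walk_evt0 s0' sx); apply: walk_branch ss' sm' sx'.
case: side => xS.
  exists jo => //; exists m.*2.+1 => s' u' b1 b2 b3.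
  by have [x' [+ /andP[]]] := key _ _ _ b1 b2 b3; rewrite jo1; lra.
exists je => //; exists m.*2.+1 => s' u' b1 b2 b3.
by have [x' [+ /andP[]]] := key _ _ _ b1 b2 b3; rewrite (negbTE je0); lra.
Qed.

Lemma walk_name_BEQ_hard s : hard_at (BEQ_pb R) walk_name both_parities s.
Proof.
move=> u A HA [hu _]; have [j Aj [M hM]] := walk_name_BE_hard HA hu.
by exists j => //; exists M => s' u' b1 [b2 _]; apply: hM b2.
Qed.

End walks.

(** * Degenerate quotients: hard instances of [RDIV_pb] *)

Fixpoint quot_vals (s : baire) (n : nat) : rat * rat :=
  if n is m.+1 then
    let v := quot_vals s m in
    if v.2 != 0 then v else
    if s m == 0%N then (0, 0) else (2^-1 ^+ m.+1 / (s m)%:R, 2^-1 ^+ m.+1)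
  else (0, 0).

(* 0 / 0 as long as s is 0; the first nonzero entry d, at m, turns it into
   (2^-(m+1) / d) / 2^-(m+1). *)
Definition quot_name (s : baire) : baire :=
  bpair (fun n => pickle (quot_vals s n).1) (fun n => pickle (quot_vals s n).2).

Lemma quot_vals_agree s s' n : agree n s s' -> quot_vals s n = quot_vals s' n.
Proof.
elim: n => [//|n IH] ss' /=; rewrite IH; last exact: agreeW ss'.
by rewrite ss'.
Qed.

Lemma quot_name_mono : prefix_monotone quot_name.
Proof.
move=> M s s' ss' n nM; rewrite /quot_name /bpair.
have h : quot_vals s n./2 = quot_vals s' n./2.
  by apply: quot_vals_agree; apply: agreeW ss'; lia.
by rewrite h.
Qed.

Section quotients.
Variable R : realType.
Local Notation hpow := (hpow R).

Lemma quot_vals_zero n : quot_vals zero_seq n = (0, 0).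
Proof. by elim: n => [//|n IH] /=; rewrite IH eqxx. Qed.

Lemma quot_vals_branch s j m n : agree m zero_seq s -> s m = j.+1 ->
  quot_vals s n =
    if (n <= m)%N then (0, 0) else (2^-1 ^+ m.+1 / j.+1%:R, 2^-1 ^+ m.+1).
Proof.
move=> s0 sm; elim: n => [//|n IH] /=; rewrite IH.
have [nm|nm] := ltnP n m; first by rewrite (ltnW nm) /= -(s0 _ nm).
have [->|/eqP nm'] := eqVneq n m; first by rewrite leqnn /= sm.
rewrite (_ : (n <= m)%N = false) /=; last by apply/negbTE; lia.
by rewrite expf_neq0.
Qed.

Lemma cauchy_name_step (c : rat) m : 0 <= c <= 2^-1 ^+ m.+1 ->
  cauchy_name (fun n => pickle (if (n <= m)%N then 0 else c)) (ratr c : R).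
Proof.
move=> c0.
have cm : 0 <= (ratr c : R) <= hpow m.+1.
  by rewrite ler0q -ratr_hpow ler_rat.
apply: (@cauchy_nameI _ _ _ (fun n => if (n <= m)%N then 0 else c)) => //.
  move=> n k nk; rewrite -(ltr_rat R) ratr_norm rmorphB/= ratr_hpow.
  have h := hpow_gt0 R n.
  have [nm|nm] := leqP n m; have [km|km] := leqP k m; rewrite ?rmorph0 ?subrr ?normr0//.
    have := hpow_le R nm; have := hpow_gt0 R m; rewrite sub0r normrN.
    rewrite hpowS in cm; rewrite ger0_norm; lra.
  exfalso; lia.
move=> n; have h := hpow_gt0 R n; have [nm|nm] := leqP n m; last first.
  by rewrite subrr normr0 ltW.
have := hpow_le R nm; have := hpow_gt0 R m; rewrite rmorph0 sub0r normrN.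
rewrite hpowS in cm; rewrite ger0_norm; lra.
Qed.

Lemma quot_name_zero_dom : dom (RDIV_pb R) (quot_name zero_seq).
Proof.
exists (fun=> pickle (0 : rat)), 0, 0, 0.
have h : cauchy_name (fun=> pickle (0 : rat)) (0 : R).
  apply: (@cauchy_nameI _ _ _ (fun=> 0)) => // n.
    by move=> k _; rewrite subrr normr0 exprn_gt0.
  by rewrite rmorph0 subrr normr0 ltW// hpow_gt0.
split => //; [by split; lra| |by split; [lra|rewrite mul0r]].
rewrite /quot_name bfstK bsndK.
by split; under eq_fun do rewrite quot_vals_zero.
Qed.

Lemma quot_name_branch_names s j m : agree m zero_seq s -> s m = j.+1 ->
  cauchy_name (bfst (quot_name s)) (hpow m.+1 / j.+1%:R : R) /\
  cauchy_name (bsnd (quot_name s)) (hpow m.+1).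
Proof.
move=> s0 sm; rewrite /quot_name bfstK bsndK.
have p0 : 0 < (2^-1 : rat) ^+ m.+1 by rewrite exprn_gt0.
split.
  have -> : hpow m.+1 / j.+1%:R = ratr (2^-1 ^+ m.+1 / j.+1%:R).
    by rewrite rmorphM/= ratr_hpow fmorphV/= rmorph_nat.
  have := @cauchy_name_step (2^-1 ^+ m.+1 / j.+1%:R) m.
  rewrite divr_ge0 ?(ltW p0)//= ler_pdivrMr// ler_peMr ?ler1n ?(ltW p0)//.
  move=> /(_ isT); congr cauchy_name; apply/funext => n.
  by rewrite (quot_vals_branch _ s0 sm); case: ifP.
have := @cauchy_name_step (2^-1 ^+ m.+1) m.
rewrite (ltW p0) lexx ratr_hpow => /(_ isT); congr cauchy_name; apply/funext => n.
by rewrite (quot_vals_branch _ s0 sm); case: ifP.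
Qed.

Lemma inv_succ_itv j : 0 <= (j.+1%:R^-1 : R) <= 1.
Proof. by rewrite invr_ge0 ler0n invf_le1// ler1n. Qed.

Lemma quot_name_branch_dom s j m : agree m zero_seq s -> s m = j.+1 ->
  dom (RDIV_pb R) (quot_name s).
Proof.
move=> s0 sm; have [nx ny] := quot_name_branch_names s0 sm.
have [u hu] := strict_grid_name_exists (inv_succ_itv j).
have /andP[i0 i1] := inv_succ_itv j.
have h0 := hpow_gt0 R m.+1.
have h1 : hpow m.+1 <= 1 by apply: exprn_ile1; lra.
exists u, (hpow m.+1 / j.+1%:R), (hpow m.+1), j.+1%:R^-1.
split => //.
- have e1 : 0 <= hpow m.+1 / j.+1%:R by apply: mulr_ge0 => //; exact: ltW.
  have e2 : hpow m.+1 / j.+1%:R <= hpow m.+1 by apply: ler_piMr => //; exact: ltW.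
  by rewrite e1 (le_trans e2 h1) (ltW h0) h1.
- by split => //; exact: inv_succ_itv.
- exact/grid_name_cauchy/strict_grid_nameW.
Qed.

(** On the [j]-th branch the quotient is 1/(j+1). Two such values are separated, so [u] can be close
    to names of at most one of them. *)
Lemma quot_name_hard : hard_at (RDIV_pb R) quot_name unbounded zero_seq.
Proof.
move=> u A /unbounded_two[j1 [j2 [A1 A2 j12]]] [_ [_ [z [_ _ _ uz]]]].
have key s' u' j : branch zero_seq j s' -> RDIV_pb R (quot_name s') u' ->
    cauchy_name u' (j.+1%:R^-1 : R).
  move=> [m [s0 sm _]] [x [y [z' [_ [hx hy] [_ xyz] hz]]]].
  have [hx' hy'] := quot_name_branch_names s0 sm.
  move: xyz; rewrite (cauchy_name_uniq hx hx') (cauchy_name_uniq hy hy').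
  by move/(mulfI (lt0r_neq0 (hpow_gt0 R m.+1))) => ->.
have gap : 0 < (j1.+1%:R^-1 - j2.+1%:R^-1 : R).
  by rewrite subr_gt0 ltf_pV2 ?posrE ?ltr0n// ltr_nat.
(* A quarter of the gap, because each of the two agreements costs [2 * hpow M]. *)
have [|M hM] := @hpow_lt R ((j1.+1%:R^-1 - j2.+1%:R^-1) / 4); first exact: divr_gt0.
pose avoid j := forall s' u', branch zero_seq j s' ->
  RDIV_pb R (quot_name s') u' -> ~ agree M.+1 u u'.
have [h1|h1] := pselect (avoid j1); first by exists j1 => //; exists M.+1.
exists j2 => //; exists M.+1 => s2 u2 b2 r2 a2; apply: h1 => s1 u1 b1 r1 a1.
have := cauchy_name_dist uz (key _ _ _ b1 r1) (a1 M (ltnSn M)).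
have := cauchy_name_dist uz (key _ _ _ b2 r2) (a2 M (ltnSn M)).
rewrite !ler_norml; move: gap hM.
move: (j1.+1%:R^-1) (j2.+1%:R^-1) => w1 w2 ? ? /andP[? ?] /andP[? ?]; lra.
Qed.

End quotients.

(** * Hard instances of IVT *)

Local Arguments pl {R} s t.
Local Arguments function_code {R} P f.
Local Arguments near_graph {R} h e a.

(** An increasing sequence in (0, 1); the intervals from knot 2j to knot 2j+1 are pairwise
    disjoint. *)
Definition knot (k : nat) : rat := 1 - k.+2%:R^-1.

Lemma knot_itv k : 0 < knot k < 1.
Proof.
rewrite /knot subr_gt0 invf_lt1 ?ltr0n// ltr1n/=.
by rewrite ltrBlDr ltrDl invr_gt0.
Qed.

Lemma knot_lt k l : (k < l)%N -> knot k < knot l.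
Proof.
by move=> kl; rewrite /knot ltrD2l ltrN2 ltf_pV2 ?posrE ?ltr0n// ltr_nat.
Qed.

Definition subplateau (d : nat) (I : rat * rat) : rat * rat :=
  if d is j.+1 then (I.1 + (I.2 - I.1) * knot j.*2,
                     I.1 + (I.2 - I.1) * knot j.*2.+1)
  else I.

Fixpoint plateau (s : baire) (n : nat) : rat * rat :=
  if n is m.+1 then subplateau (s m) (plateau s m) else (4^-1, 3 / 4).

Definition plateau_code (s : baire) (n : nat) : seq (rat * rat) :=
  [:: (0, -1); ((plateau s n).1, 0); ((plateau s n).2, 0); (1, 1)].

Definition plateau_name (s : baire) : baire :=
  fun n => pickle (plateau_code s n).

Lemma plateau_agree s s' n : agree n s s' -> plateau s n = plateau s' n.
Proof.
elim: n => [//|n IH] ss' /=; rewrite IH; last exact: agreeW ss'.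
by rewrite ss'.
Qed.

Lemma plateau_name_mono : prefix_monotone plateau_name.
Proof.
move=> M s s' ss' n nM.
have e : plateau s n = plateau s' n.
  by apply: plateau_agree; apply: agreeW ss'; apply: ltnW.
have ec : plateau_code s n = plateau_code s' n by rewrite /plateau_code e.
by congr pickle; exact: ec.
Qed.

Lemma subplateau_itv d I : I.1 < I.2 ->
  [/\ I.1 <= (subplateau d I).1, (subplateau d I).1 < (subplateau d I).2
    & (subplateau d I).2 <= I.2].
Proof.
case: d => [|j] h /=; first by split => //; lra.
have /andP[a1 a2] := knot_itv j.*2; have /andP[a3 a4] := knot_itv j.*2.+1.
have := knot_lt (ltnSn j.*2); split; nra.
Qed.

Lemma plateau_itv s n :
  [/\ 4^-1 <= (plateau s n).1, (plateau s n).1 < (plateau s n).2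
    & (plateau s n).2 <= 3 / 4].
Proof.
elim: n => [|n [h1 h2 h3]]; first by split; rewrite /=; lra.
by have [h4 h5 h6] := subplateau_itv (s n) h2; split => //=; lra.
Qed.

Lemma plateau_nested s n m : (n <= m)%N ->
  (plateau s n).1 <= (plateau s m).1 /\ (plateau s m).2 <= (plateau s n).2.
Proof.
elim: m => [|m IH]; first by rewrite leqn0 => /eqP->; split; exact: lexx.
rewrite leq_eqVlt => /orP[/eqP->|nm]; first by split; exact: lexx.
have [h1 h2] := IH nm.
have [_ h3 _] := plateau_itv s m.
by have [h4 h5 h6] := subplateau_itv (s m) h3; split => /=; lra.
Qed.

Lemma plateau_const s m n : (forall k, (m <= k)%N -> s k = 0%N) -> (m <= n)%N ->
  plateau s n = plateau s m.
Proof.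
move=> s0; elim: n => [|n IH]; first by rewrite leqn0 => /eqP->.
by rewrite leq_eqVlt => /orP[/eqP->//|mn] /=; rewrite s0//= IH.
Qed.

Section plateaus.
Variable R : realType.
Implicit Types (a b t u v : R).

Lemma uniform_cvgP (F : nat -> R -> R) (f : R -> R) :
  {uniform `[0, 1]%classic, F @ \oo --> f} <->
  forall e : R, 0 < e -> exists N, forall n, (N <= n)%N -> forall t : R,
    0 <= t <= 1 -> `|f t - F n t| < e.
Proof.
split=> [h e e0|h P /uniform_nbhs[E [entE EP]]].
  have : nbhs (f : {uniform` `[0, 1]%classic -> R})
      [set g | forall t, `[0, 1]%classic t -> ball (f t) e (g t)].
    apply/uniform_nbhs; exists [set xy | ball xy.1 e xy.2]; split => //.
    exact: (@entourage_ball _ _ (PosNum e0)).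
  move=> /h[N _ hN]; exists N => n Nn t t01.
  by have := hN n Nn t; rewrite /= in_itv/= t01 => /(_ isT).
move: entE; rewrite -entourage_from_ballE => -[e /= e0 eE].
have [N hN] := h e e0; exists N => // n /= Nn; apply: EP => t.
by rewrite /= in_itv/= => t01; apply: eE; apply: hN.
Qed.

(** [npart] and [ppart] are min(u, 0) and max(u, 0), written through the absolute value to inherit
    its continuity and Lipschitz bound. *)
Definition npart u : R := (u - `|u|) / 2.
Definition ppart u : R := (u + `|u|) / 2.

Lemma npart_le0 u : u <= 0 -> npart u = u.
Proof. by move=> u0; rewrite /npart ler0_norm//; lra. Qed.

Lemma npart_ge0 u : 0 <= u -> npart u = 0.
Proof. by move=> u0; rewrite /npart ger0_norm//; lra. Qed.

Lemma ppart_le0 u : u <= 0 -> ppart u = 0.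
Proof. by move=> u0; rewrite /ppart ler0_norm//; lra. Qed.

Lemma ppart_ge0 u : 0 <= u -> ppart u = u.
Proof. by move=> u0; rewrite /ppart ger0_norm//; lra. Qed.

Lemma npart_dist u v : `|npart u - npart v| <= `|u - v|.
Proof.
have /andP[h1 h2] : - `|u - v| <= u - v <= `|u - v| by rewrite -ler_norml.
have := ler_dist_dist u v; rewrite /npart !ler_norml => /andP[h3 h4].
by apply/andP; split; lra.
Qed.

Lemma ppart_dist u v : `|ppart u - ppart v| <= `|u - v|.
Proof.
have /andP[h1 h2] : - `|u - v| <= u - v <= `|u - v| by rewrite -ler_norml.
have := ler_dist_dist u v; rewrite /ppart !ler_norml => /andP[h3 h4].
by apply/andP; split; lra.
Qed.

(* The piecewise linear map from (0, -1) to (1, 1) that vanishes on [a, b]. *)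
Definition flat a b t : R := npart (t / a - 1) + ppart (1 - (1 - t) / (1 - b)).

(** The 16 bounds 1 / (c c'), both divisors being at least 1/4. *)
Lemma div_dist t (c c' : R) : 0 <= t <= 1 -> 4^-1 <= c -> 4^-1 <= c' ->
  `|t / c - t / c'| <= 16 * `|c - c'|.
Proof.
move=> /andP[t0 t1] hc hc'.
have c0 : 0 < c by lra.
have c0' : 0 < c' by lra.
have -> : t / c - t / c' = t * (c' - c) / (c * c').
  by field; rewrite !gt_eqF.
rewrite normrM normrM normfV (ger0_norm t0) (gtr0_norm (mulr_gt0 c0 c0')) distrC.
rewrite ler_pdivrMr ?mulr_gt0//.
have : 1 <= 16 * (c * c') by nra.
have := normr_ge0 (c - c'); move: (`|c - c'|) => d d0 h.
nra.
Qed.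

Lemma flat_dist a b a' b' t : 0 <= t <= 1 -> 4^-1 <= a -> 4^-1 <= a' ->
  b <= 3 / 4 -> b' <= 3 / 4 ->
  `|flat a b t - flat a' b' t| <= 16 * (`|a - a'| + `|b - b'|).
Proof.
move=> t01 ha ha' hb hb'; rewrite /flat.
set p := npart _; set q := ppart _; set p' := npart _; set q' := ppart _.
have -> : p + q - (p' + q') = (p - p') + (q - q') by ring.
apply: le_trans (ler_normD _ _) _; rewrite mulrDr; apply: lerD.
  apply: le_trans (npart_dist _ _) _.
  have -> : t / a - 1 - (t / a' - 1) = t / a - t / a' by ring.
  exact: div_dist.
apply: le_trans (ppart_dist _ _) _.
set w := (1 - t) / (1 - b); set w' := (1 - t) / (1 - b').
have -> : 1 - w - (1 - w') = - (w - w') by ring.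
rewrite normrN; apply: le_trans (div_dist _ _ _) _; [lra|lra|lra|].
by rewrite (_ : 1 - b - (1 - b') = - (b - b')) ?normrN//; ring.
Qed.

Lemma flat_left a b t : 0 < a -> a <= b -> b < 1 -> t <= a -> flat a b t = t / a - 1.
Proof.
move=> a0 ab b1 ta; have b0 : 0 < 1 - b by lra.
rewrite /flat npart_le0; last by rewrite subr_le0 ler_pdivrMr// mul1r.
by rewrite ppart_le0 ?addr0// subr_le0 ler_pdivlMr// mul1r; lra.
Qed.

Lemma flat_mid a b t : 0 < a -> b < 1 -> a <= t -> t <= b -> flat a b t = 0.
Proof.
move=> a0 b1 ta tb; have b0 : 0 < 1 - b by lra.
rewrite /flat npart_ge0; last by rewrite subr_ge0 ler_pdivlMr// mul1r.
by rewrite ppart_le0 ?addr0// subr_le0 ler_pdivlMr// mul1r; lra.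
Qed.

Lemma flat_right a b t : 0 < a -> a <= b -> b < 1 -> b <= t ->
  flat a b t = 1 - (1 - t) / (1 - b).
Proof.
move=> a0 ab b1 tb; have b0 : 0 < 1 - b by lra.
rewrite /flat npart_ge0; last by rewrite subr_ge0 ler_pdivlMr// mul1r; lra.
by rewrite ppart_ge0 ?add0r// subr_ge0 ler_pdivrMr// mul1r; lra.
Qed.

Lemma flat_continuous a b : continuous (flat a b).
Proof.
have c1 : continuous (fun t => t / a - 1).
  move=> t; apply: cvgB; last exact: cvg_cst.
  by apply: cvgM; [exact: cvg_id|exact: cvg_cst].
have c2 : continuous (fun t => 1 - (1 - t) / (1 - b)).
  move=> t; apply: cvgB; first exact: cvg_cst.
  apply: cvgM; last exact: cvg_cst.
  by apply: cvgB; [exact: cvg_cst|exact: cvg_id].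
move=> t; apply: cvgD; apply: cvgM; try exact: cvg_cst.
  by apply: cvgB; [exact: c1|apply: cvg_norm; exact: c1].
by apply: cvgD; [exact: c2|apply: cvg_norm; exact: c2].
Qed.

Let A s n : R := ratr (plateau s n).1.
Let B s n : R := ratr (plateau s n).2.

Let AB_itv s n : [/\ 4^-1 <= A s n, A s n < B s n & B s n <= 3 / 4].
Proof.
have [h1 h2 h3] := plateau_itv s n; split.
- have := h1; rewrite -(ler_rat R) fmorphV rmorph_nat; exact.
- by rewrite ltr_rat.
- by have := h3; rewrite -(ler_rat R) rmorphM fmorphV !rmorph_nat; exact.
Qed.

Let AB_nested s n m : (n <= m)%N -> A s n <= A s m /\ B s m <= B s n.
Proof. by move=> /(plateau_nested s)[h1 h2]; rewrite !ler_rat. Qed.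

Lemma pl_plateau s n t : 0 <= t <= 1 ->
  pl (plateau_code s n) t = flat (A s n) (B s n) t.
Proof.
move=> /andP[t0 t1]; have [h1 h2 h3] := AB_itv s n.
rewrite /plateau_code /= -/(A s n) -/(B s n).
have [ta|ta] := lerP t (A s n).
  rewrite flat_left//; try lra.
  rewrite subr0 sub0r opprK mul1r fmorphV/= -/(A s n) rmorph0 rmorphN rmorph1 subr0.
  by rewrite mulrC; ring.
have [tb|tb] := lerP t (B s n).
  by rewrite flat_mid//; lra.
rewrite flat_right//; try lra.
rewrite rmorph1 t1 subr0 mul1r rmorph0 add0r fmorphV/= rmorphB rmorph1/= -/(B s n).
by field; lra.
Qed.

(** The next plateau lies inside the present one, so all four vertices are exactly on the present
    graph. *)
Lemma plateau_near s n p : p \in plateau_code s n.+1 ->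
  near_graph (pl (plateau_code s n)) (2^-1 ^+ n.+1 : R) p.
Proof.
have [h1 h2 h3] := AB_itv s n; have [h4 h5 h6] := AB_itv s n.+1.
have [h7 h8] := AB_nested s (leqnSn n).
suff on_graph : p \in plateau_code s n.+1 -> 0 <= (ratr p.1 : R) <= 1 /\
    flat (A s n) (B s n) (ratr p.1) = ratr p.2.
  move=> /on_graph[p1 p2]; exists (ratr p.1); split => //.
  rewrite pl_plateau// p2 !subrr expr0n/= addr0 sqrtr0.
  exact: ltW (hpow_gt0 R _).
have e0 : flat (A s n) (B s n) 0 = -1.
  by rewrite flat_left ?mul0r ?sub0r//; lra.
have e1 : flat (A s n) (B s n) 1 = 1.
  by rewrite flat_right ?subrr ?mul0r ?subr0//; lra.
have eA : flat (A s n) (B s n) (A s n.+1) = 0 by apply: flat_mid; lra.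
have eB : flat (A s n) (B s n) (B s n.+1) = 0 by apply: flat_mid; lra.
rewrite !inE => /or4P[] /eqP-> /=.
- by rewrite rmorph0 rmorphN rmorph1; split => //; lra.
- by rewrite -/(A s n.+1) rmorph0; split => //; lra.
- by rewrite -/(B s n.+1) rmorph0; split => //; lra.
- by rewrite rmorph1; split => //; lra.
Qed.

(** The nested plateaus may shrink to a point, hence only [a <= b]. *)
Lemma plateau_limit s : exists a b, [/\ 4^-1 <= a, a <= b, b <= 3 / 4,
  function_code (plateau_code s) (flat a b) &
  forall n, A s n <= a /\ b <= B s n].
Proof.
pose a := sup (range (A s)); pose b := inf (range (B s)).
have AB n m : A s n <= B s m.
  have [h1 h2] := AB_nested s (leq_maxl n m).
  have [h3 h4] := AB_nested s (leq_maxr n m).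
  by have [_ h5 _] := AB_itv s (maxn n m); lra.
have A0 : range (A s) !=set0 by exists (A s 0%N); exists 0%N.
have B0 : range (B s) !=set0 by exists (B s 0%N); exists 0%N.
have Aub : has_ubound (range (A s)).
  by exists (B s 0%N) => _ [n _ <-]; apply: AB.
have Blb : has_lbound (range (B s)).
  by exists (A s 0%N) => _ [n _ <-]; apply: AB.
have Aa n : A s n <= a by apply: ub_le_sup => //; exists n.
have bB n : b <= B s n by apply: ge_inf => //; exists n.
have ab : a <= b.
  apply: lb_le_inf => // _ [m _ <-]; apply: ge_sup => // _ [n _ <-]; exact: AB.
have [h1 _ h3] := AB_itv s 0.
have a4 : 4^-1 <= a := le_trans h1 (Aa 0%N).
have b4 : b <= 3 / 4 := le_trans (bB 0%N) h3.
have Acvg : A s @ \oo --> a.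
  apply: nondecreasing_cvgn => // n m nm; exact: (AB_nested s nm).1.
have Bcvg : B s @ \oo --> b.
  apply: nonincreasing_cvgn => // n m nm; exact: (AB_nested s nm).2.
exists a, b; split => //; split.
- move=> n; have [g1 g2 g3] := plateau_itv s n; split => //=.
  by rewrite g2 andbT; apply/andP; split; lra.
- by move=> n p; apply: plateau_near.
- by apply: continuous_subspaceT; apply: flat_continuous.
apply/uniform_cvgP => e e0.
(* Endpoint errors below [e / 64] are multiplied by 16 and added, which stays below [e / 2]. *)
have e64 : 0 < e / 64 by lra.
move/cvgrPdist_lt : Acvg => /(_ _ e64)[N1 _ hN1].
move/cvgrPdist_lt : Bcvg => /(_ _ e64)[N2 _ hN2].
exists (maxn N1 N2) => n; rewrite geq_max => /andP[n1 n2] t t01.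
rewrite pl_plateau//; have [g1 g2 g3] := AB_itv s n.
apply: le_lt_trans (flat_dist t01 a4 g1 b4 g3) _.
by have := hN1 n n1; have := hN2 n n2; rewrite /=; lra.
Qed.

Lemma plateau_name_dom (C : (nat -> seq (rat * rat)) -> (R -> R) -> Prop) s :
  (forall f : R -> R, f 0 = -1 -> f 1 = 1 -> C (plateau_code s) f) ->
  dom (zero_problem R C) (plateau_name s).
Proof.
move=> hC; have [a [b [a4 ab b4 code _]]] := plateau_limit s.
have [|u hu] := @strict_grid_name_exists R a; first lra.
have a0 : 0 < a by lra.
have b1 : b < 1 by lra.
exists u, (plateau_code s), (flat a b), a; split.
- exact (fun n => erefl (plateau_name s n)).
- split; [exact: code|move=> t /andP[t0 t1]].
  have [ta|ta] := lerP t a.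
    rewrite flat_left//; have : 0 <= t / a by rewrite divr_ge0// ltW.
    have : t / a <= 1 by rewrite ler_pdivrMr// mul1r.
    by move=> *; apply/andP; split; lra.
  have [tb|tb] := lerP t b; first by rewrite flat_mid ?(ltW ta)//; lra.
  have b0 : 0 < 1 - b by lra.
  rewrite flat_right ?(ltW tb)//.
  have : 0 <= (1 - t) / (1 - b) by rewrite divr_ge0//; lra.
  have : (1 - t) / (1 - b) <= 1 by rewrite ler_pdivrMr// mul1r; lra.
  by move=> *; apply/andP; split; lra.
- apply: hC; first by rewrite flat_left// ?mul0r ?sub0r//; lra.
  by rewrite flat_right// ?subrr ?mul0r ?subr0//; lra.
- by split; [lra|rewrite flat_mid].
- exact/grid_name_cauchy/strict_grid_nameW.
Qed.

(** Outside plateau [n] the later maps are at least as far from 0 as the [n]-th, since plateaus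
    shrink, so their uniform limit cannot vanish there. *)
Lemma plateau_zero s (f : R -> R) z n : function_code (plateau_code s) f ->
  0 <= z <= 1 -> f z = 0 -> A s n <= z <= B s n.
Proof.
move=> [_ _ _ /uniform_cvgP hu] z01 fz.
have [h1 h2 h3] := AB_itv s n.
have key e : 0 < e -> exists2 m, (n <= m)%N & `|flat (A s m) (B s m) z| < e.
  move=> e0; have [N hN] := hu e e0; exists (maxn n N); first exact: leq_maxl.
  have := hN _ (leq_maxr n N) z z01.
  by rewrite fz sub0r normrN pl_plateau.
have /andP[z0 z1] := z01.
apply/andP; split; rewrite leNgt; apply/negP => hz.
  have [|m nm] := key (1 - z / A s n).
    by rewrite subr_gt0 ltr_pdivrMr ?mul1r//; lra.
  have [g1 g2] := AB_nested s nm; have [g3 g4 g5] := AB_itv s m.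
  rewrite flat_left; try lra.
  have : z / A s m <= z / A s n.
    by apply: ler_wpM2l => //; rewrite lef_pV2 ?posrE//; lra.
  by rewrite ltr_norml => ? /andP[? ?]; lra.
have b0 : 0 < 1 - B s n by lra.
have [|m nm] := key (1 - (1 - z) / (1 - B s n)).
  by rewrite subr_gt0 ltr_pdivrMr ?mul1r//; lra.
have [g1 g2] := AB_nested s nm; have [g3 g4 g5] := AB_itv s m.
rewrite flat_right; try lra.
have : (1 - z) / (1 - B s m) <= (1 - z) / (1 - B s n).
  by apply: ler_wpM2l; [lra|rewrite lef_pV2 ?posrE//; lra].
by rewrite ltr_norml => ? /andP[? ?]; lra.
Qed.

Lemma plateau_name_hard C s :
  hard_at (zero_problem R C) plateau_name unbounded s.
Proof.
move=> u H /unbounded_two[j1 [j2 [H1 H2 j12]]] [_ [_ [z [_ _ _ _ uz]]]].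
have [[m s0]|ns] := pselect (evt0 s); last first.
  exists j1 => //; exists 0%N => s' u' [m [_ _ s0]].
  by case: ns; exists m.
have key s' (u' : baire) j : branch s j s' -> zero_problem R C (plateau_name s') u' ->
    exists2 z' : R, cauchy_name u' z' &
      ratr (subplateau j.+1 (plateau s m)).1 <= z' <=
      ratr (subplateau j.+1 (plateau s m)).2.
  move=> [m' [ss' sm' s0']] [P [f [z' [hP [code _] _ [z01 fz] uz']]]].
  have PE : P = plateau_code s'.
    by apply/funext => n; apply: (pcan_inj pickleK); exact: esym (hP n).
  rewrite PE in code; exists z' => //.
  have := plateau_zero m'.+1 code z01 fz.
  rewrite /A /B [plateau s' _]/= sm' -(plateau_agree ss').
  suff -> : plateau s m' = plateau s m by [].
  have [mm|mm] := leqP m m'; first exact: plateau_const.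
  by apply/esym/plateau_const => //; apply: ltnW.
have [_ I12 _] := plateau_itv s m.
have gap : 0 < (ratr (subplateau j2.+1 (plateau s m)).1
              - ratr (subplateau j1.+1 (plateau s m)).2 : R).
  rewrite subr_gt0 ltr_rat /= ltrD2l ltr_pM2l ?subr_gt0//; apply: knot_lt; lia.
have [|M hM] := @hpow_lt R ((ratr (subplateau j2.+1 (plateau s m)).1
              - ratr (subplateau j1.+1 (plateau s m)).2) / 4).
  exact: divr_gt0.
pose avoid j := forall s' (u' : baire), branch s j s' ->
  zero_problem R C (plateau_name s') u' -> ~ agree M.+1 u u'.
have [h1|h1] := pselect (avoid j1); first by exists j1 => //; exists M.+1.
exists j2 => //; exists M.+1 => s2 u2 b2 r2 a2; apply: h1 => s1 u1 b1 r1 a1.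
have [z1 n1 /andP[_ l1]] := key _ _ _ b1 r1.
have [z2 n2 /andP[l2 _]] := key _ _ _ b2 r2.
have := cauchy_name_dist uz n1 (a1 M (ltnSn M)).
have := cauchy_name_dist uz n2 (a2 M (ltnSn M)).
rewrite !ler_norml; move: gap hM l1 l2.
move: (ratr (subplateau j1.+1 (plateau s m)).2 : R) => w1.
move: (ratr (subplateau j2.+1 (plateau s m)).1 : R) => w2.
clear I12; move=> ? ? ? ? /andP[? ?] /andP[? ?]; lra.
Qed.

End plateaus.

(** * The reductions *)

(** The query is duplicated to feed the trivial factor too, where every instance is legal. *)
Lemma winning_mprod_trivial (f g : multifun) : GW_le f g ->
  exists sd rep, winning f (mprod g trivial_pb) sd rep.
Proof.
move=> /GW_le_winning; apply: (@winning_translate f g _ (fun u => bpair u u) bfst).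
- by move=> M; exists M => u v uv; apply: agree_bpair.
- by move=> M; exists M.*2 => u v; apply: agree_bfst.
- move=> u [b gb]; exists (bpair b zero_seq).
  by rewrite /mprod /= !bfstK !bsndK.
- by move=> u b [+ _]; rewrite bfstK.
Qed.

Lemma winning_trivial_mprod (f g : multifun) : GW_le f g ->
  exists sd rep, winning f (mprod trivial_pb g) sd rep.
Proof.
move=> /GW_le_winning; apply: (@winning_translate f g _ (fun u => bpair u u) bsnd).
- by move=> M; exists M => u v uv; apply: agree_bpair.
- by move=> M; exists M.*2 => u v; apply: agree_bsnd.
- move=> u [b gb]; exists (bpair zero_seq b).
  by rewrite /mprod /= !bfstK !bsndK.
- by move=> u b [_]; rewrite bsndK.
Qed.

Section reductions.
Variable R : realType.

(** Hardness of [quot_name] is established at [zero_seq], so the argument that keeps the position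
    there applies, with the trivial problem as continuous factor. *)
Lemma RDIV_not_le_BE : ~ GW_le (RDIV_pb R) (BE_pb R).
Proof.
move=> /winning_trivial_mprod[sd [rep W]].
apply: (continuous_times_compact_false unbounded_up quot_name_mono (BE_compact R)
  (@BE_regular R) trivial_tame W).
- by [].
- exact: quot_name_hard.
- exact: quot_name_zero_dom.
move=> j; exists j => // M.
pose s : baire := fun k => if (k < M)%N then 0%N else j.+1.
have s0 : agree M zero_seq s by move=> k kM; rewrite /s kM.
have sM : s M = j.+1 by rewrite /s ltnn.
by exists s; split => //; [exists M|apply: quot_name_branch_dom s0 sM].
Qed.

Lemma BEQ_not_le_RDIV : ~ GW_le (BEQ_pb R) (RDIV_pb R).
Proof.
move=> /winning_mprod_trivial[sd [rep W]].
apply: (tame_times_compact_false both_parities_up walk_name_mono trivial_compact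
  (trivial_regular both_parities_up) (RDIV_tame R) W).
- exact: both_paritiesT.
- exact: walk_name_BEQ_hard.
- exact: walk_name_BEQ_dom.
Qed.

Lemma IVTlin_not_le_RDIV_BE :
  ~ GW_le (IVTlin_pb R) (mprod (RDIV_pb R) (BE_pb R)).
Proof.
move=> /GW_le_winning[sd [rep W]].
apply: (tame_times_compact_false unbounded_up plateau_name_mono (BE_compact R)
  (@BE_regular R) (RDIV_tame R) W).
- exact: unboundedT.
- exact: plateau_name_hard.
(* Eventually zero sequences give eventually constant codes, as [IVTlin_pb] demands. *)
move=> s [m s0]; apply: plateau_name_dom => f f0 f1; split.
  by rewrite f0 f1; lra.
by exists m => n mn; rewrite /plateau_code (plateau_const s0 mn).
Qed.

Lemma BE_not_le_DML_DNE : ~ GW_le (BE_pb R) (mprod DML_pb DNE_pb).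
Proof.
move=> /winning_mprod_trivial[sd [rep W]].
apply: (generic_game_false both_parities_up _ both_paritiesT walk_name_mono _
  _ trivial_compact (trivial_regular both_parities_up) W).
- by move=> A [[j Aj _] _]; exists j.
- exact: walk_name_BE_dom.
- exact: walk_name_BE_hard.
Qed.

Lemma IVT_not_le_DML_DNE_BE :
  ~ GW_le (IVT_pb R) (mprod (mprod DML_pb DNE_pb) (BE_pb R)).
Proof.
move=> /GW_le_winning[sd [rep W]].
apply: (generic_game_false unbounded_up _ unboundedT plateau_name_mono _
  _ (BE_compact R) (@BE_regular R) W).
- by move=> A /(_ 0%N)[j _ Aj]; exists j.
- by move=> s; apply: plateau_name_dom => f f0 f1; rewrite f0 f1; lra.
- exact: plateau_name_hard.
Qed.

End reductions.

Theorem theorem2p8 (R : realType) :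
  ~ GW_le (RDIV_pb R) (BE_pb R) /\
  ~ GW_le (BEQ_pb R) (RDIV_pb R) /\
  ~ GW_le (IVTlin_pb R) (mprod (RDIV_pb R) (BE_pb R)) /\
  ~ GW_le (BE_pb R) (mprod DML_pb DNE_pb) /\
  ~ GW_le (IVT_pb R) (mprod (mprod DML_pb DNE_pb) (BE_pb R)).
Proof.
split; first exact: RDIV_not_le_BE.
split; first exact: BEQ_not_le_RDIV.
split; first exact: IVTlin_not_le_RDIV_BE.
split; first exact: BE_not_le_DML_DNE.
exact: IVT_not_le_DML_DNE_BE.
Qed.
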